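(* Let $W, W_1,W_2,\ldots$ be a sequence of i.i.d. nonnegative random variables with finite mean $\mathbb{E} W$, and let $(a_n)_{n\ge1}$ be a sequence of positive real numbers such that $$\frac{W_1+\cdots+W_n-n\,\mathbb{E} W}{a_n}\stackrel{d}{\longrightarrow} F\qquad\text{as } n\to\infty,$$ where $F$ is a (nondegenerate) stable distribution with characteristic exponent $\alpha$, $1<\alpha<2$. For each $n\ge 1$ let $E_n$ be the total number of edges of the generalized random graph on the vertex set $\{1,\dots,n\}$ with random vertex weights $W_1,\dots,W_n$. Then $$\frac{2E_n-n\,\mathbb{E} W}{a_n}\stackrel{d}{\longrightarrow} F\qquad\text{as } n\to\infty.$$
   Context: Generalized random graph with vertex weights $W_1,\dots,W_n$: the vertex set is $\{1,\dots,n\}$ and there are no self-loops. Let $L_n=\sum_{i=1}^n W_i$ be the total weight. Conditionally on $W_1,\dots,W_n$, the edges between distinct pairs of vertices $1\le i<j\le n$ occur independently, the edge between $i$ and $j$ being present with probability $$p_{ij}=\frac{W_iW_j}{L_n+W_iW_j}$$ (with the convention $p_{ij}=0$ if $L_n=0$). Writing $I_{ij}$ for the indicator that the edge between $i$ and $j$ is present, the total number of edges is $E_n=\sum_{1\le i<j\le n} I_{ij}$. Here $\stackrel{d}{\longrightarrow}$ denotes convergence in distribution. *)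

(* Defs.v *)
From HB Require Import structures.
From mathcomp Require Import all_boot all_order all_algebra finmap.
From mathcomp Require Import all_classical all_reals all_analysis.
From mathcomp Require Import measurable_realfun.

Set Implicit Arguments.
Unset Strict Implicit.
Unset Printing Implicit Defensive.

Import Order.TTheory GRing.Theory Num.Theory.
Import numFieldNormedType.Exports.

Local Open Scope classical_set_scope.
Local Open Scope ring_scope.

(* Laws are compared on measurable sets only: a measure may take arbitrary
   values on the other sets. *)
Definition identically_distributed d (T : measurableType d) (R : realType)
    (P : probability T R) (X Y : {RV P >-> R}) : Prop :=
  forall B : set R, measurable B -> distribution P X B = distribution P Y B.

Definition mutually_independent d (T : measurableType d) (R : realType)
    (P : probability T R) (I : choiceType) (X : I -> {RV P >-> R}) : Prop :=
  forall (J : {fset I}) (B : I -> set R),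
    (forall i, i \in J -> measurable (B i)) ->
    P (\bigcap_(i in [set` J]) (X i @^-1` B i)) =
    (\prod_(i <- J) P (X i @^-1` B i))%E.

(* Weak convergence of the laws of the [X n] to [F], by bounded continuous
   test functions. *)
Definition cvg_in_distribution d (T : measurableType d) (R : realType)
    (P : probability T R) (X : nat -> T -> R) (F : probability R R) : Prop :=
  forall f : R -> R, continuous f -> (exists M : R, forall x, `|f x| <= M) ->
    ('E_P[f \o X n] @[n --> \oo] --> \int[F]_x (f x)%:E)%E.

Definition pair_add (R : realType) (z : R * R) : R := z.1 + z.2.

Lemma measurable_pair_add (R : realType) :
  measurable_fun [set: R * R] (@pair_add R).
Proof. by apply: measurable_funD; [exact: measurable_fst|exact: measurable_snd]. Qed.

HB.instance Definition _ (R : realType) :=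
  isMeasurableFun.Build _ _ (R * R)%type R (@pair_add R)
    (@measurable_pair_add R).

Definition convolution (R : realType) (mu nu : probability R R) :
    probability R R :=
  distribution (mu \x nu)%E (@pair_add R).

(* The law of the sum of [k] independent variables of law [mu]. *)
Definition convolution_power (R : realType) (mu : probability R R) (k : nat) :
    probability R R :=
  iter k (convolution mu) (\d_(0 : R)).

(* Stability in the broad sense: [mu] is not concentrated at a point, and the
   sum of [k] independent copies of [X ~ mu] has the law of
   [k^(1/alpha) X + b] for some centering [b] depending on [k]; the norming
   exponent defines the characteristic exponent [alpha]. *)
Definition stable_law (R : realType) (alpha : R) (mu : probability R R) :
    Prop :=
  (forall c : R, mu [set c] <> 1%E) /\
  (forall k : nat, (0 < k)%N -> exists b : R,
     forall B : set R, measurable B ->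
       convolution_power mu k B =
       pushforward mu (fun x : R => k%:R `^ alpha^-1 * x + b) B).

(* [q] is a version of the conditional probability of the event [A] given the
   sub-sigma-algebra [G]. *)
Definition is_cond_probability d (T : measurableType d) (R : realType)
    (P : probability T R) (G : set (set T)) (A : set T) (q : T -> R) : Prop :=
  (forall Y : set R, measurable Y -> G (q @^-1` Y)) /\
  (forall B : set T, G B -> P (A `&` B) = (\int[P]_(w in B) (q w)%:E)%E).

Definition grg_prob (R : realType) (n : nat) (x : 'I_n -> R) (i j : 'I_n) : R :=
  let L := \sum_(k < n) x k in
  if L == 0 then 0 else x i * x j / (L + x i * x j).

(* Given the weights, the edges [i < j] are present independently,
   with probabilities [grg_prob]: the conditional probability that all edges of a
   set [S] are present is the product of their probabilities. *)
Definition generalized_random_graph d (T : measurableType d) (R : realType)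
    (P : probability T R) (n : nat) (W : 'I_n -> {RV P >-> R})
    (G : T -> rel 'I_n) : Prop :=
  [/\ forall w, symmetric (G w) /\ irreflexive (G w),
      forall i j, measurable [set w | G w i j] &
      forall S : {set 'I_n * 'I_n}, (forall e, e \in S -> (e.1 < e.2)%N) ->
        is_cond_probability P (g_sigma_preimage (fun i => W i : T -> R))
          [set w | forall e, e \in S -> G w e.1 e.2]
          (fun w => \prod_(e in S) grg_prob (fun i => W i w) e.1 e.2)].

Definition num_edges (n : nat) (g : rel 'I_n) : nat :=
  (\sum_(i < n) \sum_(j < n | i < j) g i j)%N.

(* Main.v *)
Require Import Defs.
From HB Require Import structures.
From mathcomp Require Import all_boot all_order all_algebra.
From mathcomp Require Import all_classical all_reals all_analysis.
From mathcomp Require Import finmap ring lra measurable_realfun.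

(* Write [S_n] for the total weight and [p_e] for the conditional edge
   probabilities, so that [2 E_n - S_n = 2 (E_n - sum p_e) + (2 sum p_e - S_n)].
   The first bracket has second moment at most [n E W].  Up to sign the second one
   is [sum_i W_i^2 / S_n + sum_(i <> j) q^2 / (1 + q)] with [q = W_i W_j / S_n], which
   is of order [n^(2 - g)] as soon as [E W^g < oo] with [1 < g < 2].  Since
   [(2 - alpha) alpha < 1], Slutsky's lemma reduces the theorem to two facts:
   [W] has moments of all orders [g < alpha], and [a_n] eventually exceeds
   [c n^(1 / b')] for every [b' > alpha].

   Both follow from the squared moduli of characteristic functions.  If [phi] and
   [psi] are those of [W] and [F], convergence in distribution gives
   [phi (t / a_n)^n --> psi t], and stability gives [psi (k^(1/alpha) t) = psi t^k].
   Hence [n Psi (t / a_n)] is comparable to [t^alpha], where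
   [Psi u = E min (1, u^2 (W - W')^2)] with [W'] an independent copy of [W].  As
   [Psi] is monotone, this forces [u^b' <~ Psi u <~ u^b] near [0] for all
   [b < alpha < b']; the upper bound yields the moments of [W], the lower one the
   growth of [a_n]. *)

Set Implicit Arguments.
Unset Strict Implicit.
Unset Printing Implicit Defensive.

Import Order.TTheory GRing.Theory Num.Theory.
Import numFieldNormedType.Exports.

Local Open Scope classical_set_scope.
Local Open Scope ring_scope.

(** * Elementary inequalities *)

(** Squared moduli are real and blind to translations, so neither the centering [n E W] nor the
    unknown shifts of the stable law appear, and no complex logarithm is taken: [n]-th powers are
    undone by two Bernoulli-type inequalities. The price is that limits become two-sided bounds with
    constants. These constants do not depend on the scale ratio, so a small ratio absorbs them at
    the cost of an arbitrarily small change of exponent. [1 - |phi|^2] need not be monotone, hence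
    [Psi]. Bounding [Psi u] above takes the average of [1 - |phi (s u)|^2] over all [s] in [[0, 1]],
    so the pointwise convergence of the squared moduli must first be made uniform in [s]; tightness
    provides this. Two more properties of [a_n] enter the final estimate. Since [alpha > 1], [a_n]
    is negligible against [n], so [S_n] exceeds [n E W / 2] with high probability and its negative
    powers are under control. Since [alpha < 2], [a_n] dominates [n^(1/2)], the size of the edge
    fluctuations. *)

Lemma norm_cosB_le (R : realType) (x y : R) : `|cos x - cos y| <= `|x - y|.
Proof.
wlog xy : x y / y <= x.
  move=> H; have [/H//|/ltW/H] := leP y x.
  by rewrite distrC [leRHS]distrC.
have [c _ ->] := @MVT_segment R cos (fun z => - sin z) y x xy
  (fun z _ => is_derive_cos z) (continuous_subspaceT (@continuous_cos R)).
by rewrite normrM normrN ler_piMl// sin_max.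
Qed.

Lemma norm_sinB_le (R : realType) (x y : R) : `|sin x - sin y| <= `|x - y|.
Proof.
wlog xy : x y / y <= x.
  move=> H; have [/H//|/ltW/H] := leP y x.
  by rewrite distrC [leRHS]distrC.
have [c _ ->] := @MVT_segment R sin cos y x xy
  (fun z _ => is_derive_sin z) (continuous_subspaceT (@continuous_sin R)).
by rewrite normrM ler_piMl// cos_max.
Qed.

Lemma onem_cosE (R : realType) (x : R) : 1 - cos x = 2 * sin (x / 2) ^+ 2.
Proof.
have -> : cos x = cos ((x / 2) *+ 2) by congr cos; rewrite mulr2n; lra.
by rewrite cos_mulr2n sin2cos2 mulr2n; ring.
Qed.

Lemma onem_cos_le_sqr (R : realType) (x : R) : 1 - cos x <= x ^+ 2 / 2.
Proof.
rewrite onem_cosE.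
have : sin (x / 2) ^+ 2 <= (x / 2) ^+ 2.
  rewrite -[leLHS]real_normK ?num_real// -[leRHS]real_normK ?num_real// lerXn2r ?nnegrE//.
  by have := norm_sinB_le (x / 2) 0; rewrite sin0 !subr0.
by lra.
Qed.

(** The mean value theorem for [sin] on [[0, |x| / 2]], a subinterval of [[0, 1]], where the
    derivative is at least [cos 1]. *)
Lemma onem_cos_ge_sqr (R : realType) (x : R) : `|x| <= 2 ->
  cos 1 ^+ 2 * x ^+ 2 / 2 <= 1 - cos x.
Proof.
move=> x2; rewrite -(cos_norm x) -[x ^+ 2]real_normK ?num_real//; set y := `|x| in x2 *.
have y0 : 0 <= y by exact: normr_ge0.
rewrite onem_cosE.
have y20 : 0 <= y / 2 by rewrite divr_ge0.
have [c /[!in_itv]/= /andP[c0 cy]] := @MVT_segment R sin cos 0 (y / 2) y20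
  (fun z _ => is_derive_sin z) (continuous_subspaceT (@continuous_sin R)).
rewrite sin0 !subr0 => ->.
have pi2 := @pi_ge2 R.
have c1 : cos 1 <= cos c.
  have [->//|c1] := eqVneq c 1.
  rewrite leNgt ltr_cos ?in_itv/=; last 2 first.
  - by apply/andP; split; lra.
  - by apply/andP; split; lra.
  by rewrite -leNgt; lra.
have := @cos1_gt0 R => c10.
have : cos 1 ^+ 2 <= cos c ^+ 2 by rewrite lerXn2r ?nnegrE//; lra.
move=> h; have := ler_wpM2r (sqr_ge0 y) h; lra.
Qed.

Lemma bernoulli_le (R : realType) (p : R) n : 0 <= p <= 1 ->
  1 - n%:R * p <= (1 - p) ^+ n.
Proof.
move=> /andP[p0 p1]; elim: n => [|n IH]; first by rewrite expr0 mul0r subr0.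
rewrite exprSr -natr1.
have h : 0 <= 1 - p by lra.
apply: le_trans (ler_wpM2r h IH).
have : 0 <= n%:R * p * p by rewrite !mulr_ge0.
lra.
Qed.

(** With [bernoulli_le] this replaces the logarithm: a lower bound on [(1 - p) ^+ n] bounds [n p]
    above by this lemma, and an upper bound on it bounds [n p] below by the other. *)
Lemma expr_onem_le (R : realType) (p : R) n : 0 <= p <= 1 ->
  (1 - p) ^+ n * (1 + n%:R * p) <= 1.
Proof.
move=> /andP[p0 p1].
have p1' : 0 <= 1 - p by lra.
have b : 1 + n%:R * p <= (1 + p) ^+ n.
  elim: n => [|n IH]; first by rewrite expr0 mul0r addr0.
  rewrite exprSr -natr1.
  have h : 0 <= 1 + p by lra.
  apply: le_trans (ler_wpM2r h IH).
  have : 0 <= n%:R * p * p by rewrite !mulr_ge0.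
  lra.
apply: le_trans (ler_wpM2l (exprn_ge0 n p1') b) _.
rewrite -exprMn; apply: exprn_ile1.
  by apply: mulr_ge0; lra.
have : 0 <= p * p by rewrite mulr_ge0.
lra.
Qed.

(** * Regular variation *)

Section regular_variation.
Context {R : realType} (Psi : R -> R) (a : nat -> R) (al t0 c1 c2 : R).
Context (al0 : 0 < al) (t00 : 0 < t0) (c10 : 0 < c1) (c20 : 0 < c2).
Context (a0 : forall n, (0 < n)%N -> 0 < a n).
Context (le_Psi : forall u v : R, 0 < u -> u <= v -> Psi u <= Psi v).
Context (Psi_sqr : forall l u : R, 0 < l <= 1 -> 0 < u -> l ^+ 2 * Psi u <= Psi (l * u)).
Context (Psi_bounds : forall t : R, 0 < t <= t0 -> \forall n \near \oo,
  c1 * t `^ al <= n%:R * Psi (t / a n) <= c2 * t `^ al).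

(** [Psi_bounds] gives positivity at one point [v]; monotonicity carries it above [v] and [Psi_sqr]
    below. *)
Lemma Psi_gt0 u : 0 < u -> 0 < Psi u.
Proof.
move=> u0.
have /Psi_bounds[N _ HN] : 0 < t0 <= t0 by rewrite t00/=.
have := HN N.+1 (leqnSn _) => /andP[+ _].
have : 0 < t0 / a N.+1 by rewrite divr_gt0// a0.
move: (t0 / _) => v v0 h.
have Pv : 0 < Psi v.
  rewrite -(@pmulr_rgt0 _ N.+1%:R)//; apply: lt_le_trans h.
  by rewrite mulr_gt0// powR_gt0.
have [vu|uv] := leP v u; first by rewrite (lt_le_trans Pv)// le_Psi.
have l1 : 0 < u / v <= 1 by rewrite divr_gt0//= ler_pdivrMr// mul1r ltW.
have := Psi_sqr l1 v0; rewrite divfK ?gt_eqF//; apply: lt_le_trans.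
by rewrite mulr_gt0// exprn_gt0// divr_gt0.
Qed.

Lemma Psi_cvg0 e : 0 < e -> \forall n \near \oo, Psi (t0 / a n) < e.
Proof.
move=> e0.
have t01 : 0 < t0 <= t0 by rewrite t00/=.
near=> n.
have n0 : 0 < n%:R :> R by rewrite ltr0n; near: n; exact: nbhs_infty_gt.
rewrite -(ltr_pM2l n0).
have : c1 * t0 `^ al <= n%:R * Psi (t0 / a n) <= c2 * t0 `^ al.
  by near: n; exact: Psi_bounds.
move=> /andP[_ h]; apply: (le_lt_trans h).
by rewrite -ltr_pdivrMr//; near: n; exact: nbhs_infty_gtr.
Unshelve. all: by end_near. Qed.

(** By [Psi_cvg0], [Psi (t0 / a n)] drops below the positive number [Psi u], which monotonicity
    excludes while [u <= t0 / a n]. *)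
Lemma a_cvgy u : 0 < u -> \forall n \near \oo, t0 / a n < u.
Proof.
move=> u0; near=> n.
have n0 : (0 < n)%N by near: n; exact: nbhs_infty_gt.
rewrite ltNge; apply/negP => un.
have := le_Psi u0 un; rewrite leNgt => /negP; apply.
by near: n; apply: Psi_cvg0; exact: Psi_gt0.
Unshelve. all: by end_near. Qed.

(* Given a small [u], take [n] with [n * Psi u] of order one: by monotonicity
   [u * a n] is then bounded away from [0] and [oo], which transfers the
   hypothesis from the points [t / a n] to all small [u]. *)
Lemma Psi_regular : exists C1 C2 : R, [/\ 0 < C1, 0 < C2 &
  forall l : R, 0 < l <= 1 -> exists2 u0 : R, 0 < u0 & forall u : R, 0 < u <= u0 ->
    C1 * l `^ al * Psi u <= Psi (l * u) <= C2 * l `^ al * Psi u].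
Proof.
(* The level [th] lies below [n * Psi (t0 / a n)], and [t1] is so small that [th / 2] lies above
   [n * Psi (t1 / a n)]. Hence [th / 2 <= n * Psi u <= th] will place [u] between [t1 / a n] and
   [t0 / a n]. *)
pose th := c1 * t0 `^ al / 2.
have th0 : 0 < th by rewrite divr_gt0// mulr_gt0// powR_gt0.
pose s := (th / 4 / c2) `^ al^-1.
have s0 : 0 < s by apply/powR_gt0/divr_gt0 => //; exact: divr_gt0.
pose t1 := Num.min t0 s.
have t10 : 0 < t1 by rewrite lt_min t00.
have t1t0 : t1 <= t0 by rewrite ge_min lexx.
have t1th : c2 * t1 `^ al < th / 2.
  apply: (@le_lt_trans _ _ (c2 * s `^ al)).
    rewrite ler_pM2l// ge0_ler_powR ?nnegrE ?(ltW al0) ?(ltW t10) ?(ltW s0)//.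
    by rewrite ge_min lexx orbT.
  rewrite /s -powRrM mulVf ?gt_eqF// powRr1; last by apply/ltW/divr_gt0 => //;
      exact: divr_gt0.
  by rewrite mulrCA divff ?gt_eqF//; lra.
exists (c1 * t1 `^ al / th), (c2 * t0 `^ al * (2 / th)); split.
- by rewrite divr_gt0// mulr_gt0// powR_gt0.
- by rewrite mulr_gt0// ?divr_gt0// mulr_gt0// powR_gt0.
move=> l /andP[l0 l1].
have lt0 : 0 < l * t0 <= t0 by rewrite mulr_gt0//= ler_piMl// ltW.
have lt1 : 0 < l * t1 <= t0.
  by rewrite mulr_gt0//= (le_trans _ t1t0)// ler_piMl// ltW.
have [N1 _ H1] := Psi_bounds lt0.
have [N2 _ H2] := Psi_bounds lt1.
have [N3 _ H3] : \forall n \near \oo, c1 * t0 `^ al <= n%:R * Psi (t0 / a n) <=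
    c2 * t0 `^ al.
  by apply: Psi_bounds; rewrite t00/=.
have [N4 _ H4] : \forall n \near \oo, c1 * t1 `^ al <= n%:R * Psi (t1 / a n) <=
    c2 * t1 `^ al.
  by apply: Psi_bounds; rewrite t10/=.
pose N := maxn (maxn N1 N2) (maxn N3 N4).
(* Once [Psi u] is below this value, the index [n] chosen from [u] exceeds [N], and all four
   eventual bounds apply to it. *)
have e0 : 0 < th / N.+1%:R by rewrite divr_gt0.
have [M _ HM] := Psi_cvg0 e0.
exists (t0 / a M.+1); first by rewrite divr_gt0// a0.
move=> u /andP[u0 uM].
have Pu0 := Psi_gt0 u0.
have Pu : Psi u <= th / N.+1%:R.
  by apply: le_trans (le_Psi u0 uM) _; apply/ltW/HM => /=.
pose n := Num.truncn (th / Psi u).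
have thu0 : 0 <= th / Psi u by rewrite divr_ge0// ltW.
have nN : (N < n)%N.
  by rewrite truncn_ge_nat// ler_pdivlMr// mulrC -ler_pdivlMr.
have n0 : 0 < n%:R :> R by rewrite ltr0n (leq_trans _ nN).
have /andP[nle nlt] := truncn_itv thu0.
rewrite -/n in nle nlt.
have an0 : 0 < a n by rewrite a0// (leq_trans _ nN).
have nle' : n%:R * Psi u <= th by rewrite -ler_pdivlMr.
have nge' : th <= 2 * (n%:R * Psi u).
  move: nlt; rewrite ltr_pdivrMr// => nlt.
  apply/ltW/(lt_le_trans nlt); rewrite mulrA ler_pM2r//.
  by rewrite -natrM ler_nat mul2n -addnn -addn1 leq_add2l (leq_trans _ nN).
have Nn k : (k <= N)%N -> (k <= n)%N by move/leq_ltn_trans => /(_ _ nN)/ltnW.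
have /andP[B1 _] : c1 * t0 `^ al <= n%:R * Psi (t0 / a n) <= c2 * t0 `^ al.
  by apply: H3; apply: Nn; rewrite !leq_max leqnn ?orbT.
have /andP[_ B2] : c1 * t1 `^ al <= n%:R * Psi (t1 / a n) <= c2 * t1 `^ al.
  by apply: H4; apply: Nn; rewrite !leq_max leqnn ?orbT.
have ut0 : u <= t0 / a n.
  rewrite leNgt; apply/negP => h.
  have := le_Psi (divr_gt0 t00 an0) (ltW h); rewrite -(ler_pM2l n0).
  have : th < c1 * t0 `^ al.
    by rewrite /th; have : 0 < c1 * t0 `^ al by [rewrite mulr_gt0// powR_gt0]; lra.
  lra.
have t1u : t1 / a n <= u.
  rewrite leNgt; apply/negP => h.
  have := le_Psi u0 (ltW h); rewrite -(ler_pM2l n0).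
  lra.
have /andP[_ B3] : c1 * (l * t0) `^ al <= n%:R * Psi (l * t0 / a n) <= c2 * (l * t0) `^ al.
  by apply: H1; apply: Nn; rewrite !leq_max leqnn ?orbT.
have /andP[B4 _] : c1 * (l * t1) `^ al <= n%:R * Psi (l * t1 / a n) <= c2 * (l * t1) `^ al.
  by apply: H2; apply: Nn; rewrite !leq_max leqnn ?orbT.
rewrite !powRM ?(ltW l0) ?(ltW t00) ?(ltW t10)// in B3 B4.
apply/andP; split.
  apply: (@le_trans _ _ (Psi (l * t1 / a n))); last first.
    apply: le_Psi; first by rewrite divr_gt0// mulr_gt0.
    by rewrite -mulrA ler_pM2l.
  rewrite -(ler_pM2l n0); apply: le_trans B4.
  rewrite -[leRHS]mul1r.
  rewrite [leLHS](_ : _ = (n%:R * Psi u / th) * (c1 * (l `^ al * t1 `^ al))); last first.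
    by field; rewrite gt_eqF.
  rewrite ler_wpM2r ?mulr_ge0 ?powR_ge0 ?(ltW c10)//.
  by rewrite ler_pdivrMr// mul1r.
apply: (@le_trans _ _ (Psi (l * t0 / a n))).
  by apply: le_Psi; [rewrite mulr_gt0|rewrite -mulrA ler_pM2l].
rewrite -(ler_pM2l n0); apply: (le_trans B3).
rewrite -[leLHS]mul1r.
rewrite [leRHS](_ : _ = (2 * (n%:R * Psi u) / th) * (c2 * (l `^ al * t0 `^ al)));
    last first.
  by field; rewrite gt_eqF.
rewrite ler_wpM2r ?mulr_ge0 ?powR_ge0 ?(ltW c20)//.
by rewrite ler_pdivlMr// mul1r.
Qed.

Lemma geometric_between (l u : R) : 0 < l < 1 -> 0 < u <= 1 ->
  exists m, l ^+ m.+1 < u <= l ^+ m.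
Proof.
move=> /andP[l0 l1] /andP[u0 u1].
have [m] : exists m, l ^+ m < u.
  have := @cvg_expr R l; rewrite (ger0_norm (ltW l0)) => /(_ l1)/cvgrPdist_lt/(_ _ u0).
  move=> [m _ /(_ m (leqnn m))]; rewrite sub0r normrN ger0_norm ?exprn_ge0 ?ltW//.
  by exists m.
elim: m => [|m IH] h; first by move: h; rewrite expr0 ltNge u1.
by have [/IH//|um] := ltP (l ^+ m) u; exists m; rewrite h.
Qed.

(** [C2] does not depend on [l], so a small [l] absorbs it when the exponent is lowered from [al] to
    [b]. Iterating along the points [l ^+ m * u0] and filling the gaps by monotonicity gives the
    power bound. *)
Lemma Psi_le_powR b : 0 < b < al ->
  exists2 K : R, 0 < K & forall u : R, 0 < u <= 1 -> Psi u <= K * u `^ b.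
Proof.
move=> /andP[b0 bal].
have [C1 [C2 [C10 C20 HC]]] := Psi_regular.
pose l := Num.min 2^-1 (C2^-1 `^ (al - b)^-1).
have l0 : 0 < l by rewrite lt_min invr_gt0 ltr0n powR_gt0// invr_gt0.
have l1 : l < 1 by rewrite gt_min invf_lt1// ltr1n.
have Cl : C2 * l `^ al <= l `^ b.
  rewrite -(subrK b al) powRD; last by rewrite (gt_eqF l0) implybT.
  rewrite mulrA ler_piMl ?powR_ge0//.
  have : l `^ (al - b) <= (C2^-1 `^ (al - b)^-1) `^ (al - b).
    by rewrite ge0_ler_powR ?nnegrE ?subr_ge0 ?powR_ge0 ?(ltW bal) ?(ltW l0)// ge_min
        lexx orbT.
  rewrite -powRrM mulVf ?subr_eq0 ?gt_eqF// powRr1 ?invr_ge0 ?(ltW C20)//.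
  by move/(ler_wpM2l (ltW C20)); rewrite divff ?gt_eqF.
have [u0 u00 Hu] := HC l ltac:(by rewrite l0 ltW).
have it m : Psi (l ^+ m * u0) <= (l ^+ m) `^ b * Psi u0.
  elim: m => [|m IH]; first by rewrite expr0 !mul1r powR1 mul1r.
  have um : 0 < l ^+ m * u0 <= u0.
    rewrite mulr_gt0 ?exprn_gt0//= ler_piMl ?(ltW u00)//.
    by rewrite exprn_ile1 ?ltW.
  have /andP[_] := Hu _ um; rewrite mulrA -exprS => h; apply: (le_trans h).
  rewrite exprS powRM ?exprn_ge0 ?(ltW l0)// -[leRHS]mulrA.
  apply: ler_pM => //; first by rewrite mulr_ge0 ?powR_ge0 ?ltW.
  by rewrite ltW// Psi_gt0//; case/andP: um.
(* [K0] serves [u <= u0], where rounding [u] up to the geometric grid costs the factor [l] inside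
   the power; [K1] serves [u0 < u <= 1]. *)
pose K0 := Psi u0 * (l * u0) `^ (- b).
pose K1 := Psi 1 * u0 `^ (- b).
have K00 : 0 < K0 by rewrite mulr_gt0 ?Psi_gt0// powR_gt0// mulr_gt0.
have K10 : 0 < K1 by rewrite mulr_gt0 ?Psi_gt0// powR_gt0.
exists (K0 + K1); first by rewrite addr_gt0.
move=> u /andP[ugt0 ule1]; rewrite mulrDl.
have [uu0|u0u] := leP u u0.
  have v1 : 0 < u / u0 <= 1 by rewrite divr_gt0//= ler_pdivrMr// mul1r.
  have [m] := geometric_between (introT andP (conj l0 l1)) v1.
  rewrite ltr_pdivlMr// ler_pdivrMr// => /andP[m1 m2].
  apply: (@le_trans _ _ (K0 * u `^ b)); last by rewrite lerDl mulr_ge0 ?powR_ge0 ?ltW.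
  apply: (le_trans (le_Psi ugt0 m2)); apply: (le_trans (it m)).
  rewrite mulrC /K0 -mulrA ler_pM2l ?Psi_gt0// powRN mulrC ler_pdivlMr ?powR_gt0
      ?mulr_gt0//.
  rewrite -powRM ?exprn_ge0 ?mulr_ge0 ?(ltW l0) ?(ltW u00) ?(ltW ugt0)//.
  rewrite ge0_ler_powR ?nnegrE ?mulr_ge0 ?exprn_ge0 ?(ltW b0) ?(ltW l0) ?(ltW u00)
      ?(ltW ugt0)//.
  by rewrite mulrA -exprSr ltW.
apply: (@le_trans _ _ (K1 * u `^ b)); last by rewrite lerDr mulr_ge0 ?powR_ge0 ?ltW.
apply: (le_trans (le_Psi ugt0 ule1)).
rewrite /K1 -mulrA ler_peMr ?ltW ?Psi_gt0// powRN mulrC ltr_pdivlMr ?powR_gt0// mul1r.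
by rewrite gt0_ltr_powR ?nnegrE ?ltW.
Qed.

(** The mirror image: raising the exponent from [al] to [b] lets a small [l] absorb [C1], and [u] is
    rounded down to the grid. *)
Lemma Psi_ge_powR b : al < b ->
  exists2 k : R, 0 < k & forall u : R, 0 < u <= 1 -> k * u `^ b <= Psi u.
Proof.
move=> bal.
have b0 : 0 < b by exact: lt_trans bal.
have [C1 [C2 [C10 C20 HC]]] := Psi_regular.
pose l := Num.min 2^-1 (C1 `^ (b - al)^-1).
have l0 : 0 < l by rewrite lt_min invr_gt0 ltr0n powR_gt0.
have l1 : l < 1 by rewrite gt_min invf_lt1// ltr1n.
have Cl : l `^ b <= C1 * l `^ al.
  rewrite -(subrK al b) powRD; last by rewrite (gt_eqF l0) implybT.
  rewrite ler_wpM2r ?powR_ge0//.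
  apply: (@le_trans _ _ ((C1 `^ (b - al)^-1) `^ (b - al))).
    by rewrite ge0_ler_powR ?nnegrE ?subr_ge0 ?powR_ge0 ?(ltW bal) ?(ltW l0)// ge_min
        lexx orbT.
  by rewrite -powRrM mulVf ?subr_eq0 ?gt_eqF// powRr1 ?(ltW C10).
have [u0 u00 Hu] := HC l ltac:(by rewrite l0 ltW).
have it m : (l ^+ m) `^ b * Psi u0 <= Psi (l ^+ m * u0).
  elim: m => [|m IH]; first by rewrite expr0 !mul1r powR1 mul1r.
  have um : 0 < l ^+ m * u0 <= u0.
    rewrite mulr_gt0 ?exprn_gt0//= ler_piMl ?(ltW u00)//.
    by rewrite exprn_ile1 ?ltW.
  have /andP[+ _] := Hu _ um; rewrite mulrA -exprS; apply: le_trans.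
  rewrite exprS powRM ?exprn_ge0 ?(ltW l0)// -[leLHS]mulrA.
  apply: ler_pM => //; first by rewrite powR_ge0.
  by rewrite mulr_ge0 ?powR_ge0// ltW// Psi_gt0.
pose k0 := l `^ b * Psi u0 * u0 `^ (- b).
have k00 : 0 < k0 by rewrite mulr_gt0 ?powR_gt0// mulr_gt0 ?Psi_gt0// powR_gt0.
exists (Num.min k0 (Psi u0)); first by rewrite lt_min k00 Psi_gt0.
move=> u /andP[ugt0 ule1].
have [uu0|u0u] := leP u u0.
  have v1 : 0 < u / u0 <= 1 by rewrite divr_gt0//= ler_pdivrMr// mul1r.
  have [m] := geometric_between (introT andP (conj l0 l1)) v1.
  rewrite ltr_pdivlMr// ler_pdivrMr// => /andP[m1 m2].
  apply: (@le_trans _ _ (k0 * u `^ b)).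
    by rewrite ler_wpM2r ?powR_ge0// ge_min lexx.
  apply: le_trans (le_Psi _ (ltW m1)); last by rewrite mulr_gt0 ?exprn_gt0.
  apply: le_trans (it m.+1).
  rewrite exprS powRM ?exprn_ge0 ?(ltW l0)//.
  rewrite /k0 (_ : _ * u `^ b = l `^ b * Psi u0 * (u0 `^ (- b) * u `^ b));
      last by rewrite !mulrA.
  rewrite [leRHS]mulrAC ler_pM2l ?mulr_gt0 ?powR_gt0 ?Psi_gt0//.
  rewrite powRN mulrC ler_pdivrMr ?powR_gt0// -powRM ?exprn_ge0 ?(ltW l0) ?(ltW u00)
      ?(ltW ugt0)//.
  by rewrite ge0_ler_powR ?nnegrE ?mulr_ge0 ?exprn_ge0 ?(ltW b0) ?(ltW l0) ?(ltW u00)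
      ?(ltW ugt0).
apply: (@le_trans _ _ (Psi u0)); last exact: le_Psi (ltW u0u).
apply: (@le_trans _ _ (Psi u0 * u `^ b)).
  by rewrite ler_wpM2r ?powR_ge0// ge_min lexx orbT.
rewrite ler_piMr ?(ltW (Psi_gt0 u00))//.
have := @ge0_ler_powR _ b (ltW b0) u 1; rewrite powR1 !nnegrE ltW//.
by apply.
Qed.

(** The upper power bound on [Psi] is read at [u = t0 / a n], where [n * Psi u] is bounded below.
    With [b > 1] this makes [a n] negligible against [n]. *)
Lemma norming_le b : 0 < b < al ->
  exists2 K : R, 0 < K & \forall n \near \oo, a n `^ b <= K * n%:R.
Proof.
move=> bal; have [K K0 HK] := Psi_le_powR bal; case/andP: bal => b0 bal.
have ct : 0 < c1 * t0 `^ al by rewrite mulr_gt0// powR_gt0.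
exists (K * t0 `^ b / (c1 * t0 `^ al)); first by rewrite divr_gt0// mulr_gt0// powR_gt0.
near=> n.
have n0 : (0 < n)%N by near: n; exact: nbhs_infty_gt.
have an0 := a0 n0.
have : c1 * t0 `^ al <= n%:R * Psi (t0 / a n) <= c2 * t0 `^ al.
  by near: n; apply: Psi_bounds; rewrite t00/=.
move=> /andP[h _].
have tu : 0 < t0 / a n <= 1.
  by rewrite divr_gt0//= ltW//; near: n; exact: a_cvgy.
have := le_trans h (ler_wpM2l (ler0n R n) (HK _ tu)).
rewrite -powR_inv1 ?(ltW an0)// powRM ?powR_ge0 ?(ltW t00)// powR_inv1 ?(ltW an0)//.
have -> : (a n)^-1 `^ b = (a n `^ b)^-1.
  by rewrite -powR_inv1 ?(ltW an0)// -powRrM mulrC powRrM powR_inv1 ?powR_ge0.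
rewrite !mulrA ler_pdivlMr ?powR_gt0// => h'.
rewrite mulrAC ler_pdivlMr// mulrC; apply: (le_trans h').
by rewrite le_eqVlt; apply/orP; left; apply/eqP; ring.
Unshelve. all: by end_near. Qed.

Lemma norming_ge b : al < b ->
  exists2 k : R, 0 < k & \forall n \near \oo, k * n%:R <= a n `^ b.
Proof.
move=> bal; have [k k0 Hk] := Psi_ge_powR bal.
have ct : 0 < c2 * t0 `^ al by rewrite mulr_gt0// powR_gt0.
exists (k * t0 `^ b / (c2 * t0 `^ al)); first by rewrite divr_gt0// mulr_gt0// powR_gt0.
near=> n.
have n0 : (0 < n)%N by near: n; exact: nbhs_infty_gt.
have an0 := a0 n0.
have : c1 * t0 `^ al <= n%:R * Psi (t0 / a n) <= c2 * t0 `^ al.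
  by near: n; apply: Psi_bounds; rewrite t00/=.
move=> /andP[_ h].
have tu : 0 < t0 / a n <= 1.
  by rewrite divr_gt0//= ltW//; near: n; exact: a_cvgy.
have := le_trans (ler_wpM2l (ler0n R n) (Hk _ tu)) h.
rewrite -powR_inv1 ?(ltW an0)// powRM ?powR_ge0 ?(ltW t00)// powR_inv1 ?(ltW an0)//.
have -> : (a n)^-1 `^ b = (a n `^ b)^-1.
  by rewrite -powR_inv1 ?(ltW an0)// -powRrM mulrC powRrM powR_inv1 ?powR_ge0.
rewrite !mulrA ler_pdivrMr ?powR_gt0// => h'.
rewrite mulrAC ler_pdivrMr// [leRHS]mulrC; apply: le_trans h'.
by rewrite le_eqVlt; apply/orP; left; apply/eqP; ring.
Unshelve. all: by end_near. Qed.

End regular_variation.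

(** * Characteristic functions and independence *)

(** Closed under sums, products and composition, and integrable for every probability, so that the
    integrability conditions of linearity and Fubini reduce to this predicate. *)
Definition bdd_measurable d (T : measurableType d) (R : realType) (f : T -> R) :=
  measurable_fun setT f /\ exists M : R, forall x, `|f x| <= M.

Section bdd_measurable.
Context d (T : measurableType d) (R : realType).
Implicit Types (P : probability T R) (f g X Y : T -> R).

Lemma measurable_set_ge (c : R) f : measurable_fun setT f ->
  measurable [set x | c <= f x].
Proof.
move=> mf; rewrite (_ : [set x | c <= f x] = f @^-1` `[c, +oo[).
  by rewrite -[X in measurable X]setTI; apply: mf => //; exact: measurable_itv.
by apply/seteqP; split => x; rewrite /= in_itv/= andbT.
Qed.

Lemma measurable_set_gt (c : R) f : measurable_fun setT f ->
  measurable [set x | c < f x].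
Proof.
move=> mf; rewrite (_ : [set x | c < f x] = f @^-1` `]c, +oo[).
  by rewrite -[X in measurable X]setTI; apply: mf => //; exact: measurable_itv.
by apply/seteqP; split => x; rewrite /= in_itv/= andbT.
Qed.

Lemma bdd_integrable P f : bdd_measurable f -> P.-integrable setT (EFin \o f).
Proof.
move=> [mf [M Mf]].
have Poo : (P setT < +oo)%E by rewrite probability_setT ltry.
apply: (measurable_bounded_integrable measurableT Poo mf).
exists M; split; first exact: num_real.
by move=> x Mx y _; apply: le_trans (Mf y) (ltW Mx).
Qed.

Lemma bddM f g : bdd_measurable f -> bdd_measurable g ->
  bdd_measurable (fun x => f x * g x).
Proof.
move=> [mf [M Mf]] [mg [N Ng]]; split; first exact: measurable_funM.
by exists (M * N) => x; rewrite normrM ler_pM.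
Qed.

Lemma bddD f g : bdd_measurable f -> bdd_measurable g ->
  bdd_measurable (fun x => f x + g x).
Proof.
move=> [mf [M Mf]] [mg [N Ng]]; split; first exact: measurable_funD.
by exists (M + N) => x; rewrite (le_trans (ler_normD _ _))// lerD.
Qed.

Lemma bddB f g : bdd_measurable f -> bdd_measurable g ->
  bdd_measurable (fun x => f x - g x).
Proof.
move=> [mf [M Mf]] [mg [N Ng]]; split; first exact: measurable_funB.
by exists (M + N) => x; rewrite (le_trans (ler_normB _ _))// lerD.
Qed.

Lemma bdd_cst (c : R) : bdd_measurable (fun _ : T => c).
Proof. by split; [exact: measurable_cst|exists `|c|]. Qed.

Lemma measurable_cosM (t : R) X :
  measurable_fun setT X -> measurable_fun setT (fun x => cos (t * X x)).
Proof.
move=> mX; apply: measurableT_comp; last exact: measurable_funM.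
by apply: continuous_measurable_fun; exact: continuous_cos.
Qed.

Lemma measurable_sinM (t : R) X :
  measurable_fun setT X -> measurable_fun setT (fun x => sin (t * X x)).
Proof.
move=> mX; apply: measurableT_comp; last exact: measurable_funM.
by apply: continuous_measurable_fun; exact: continuous_sin.
Qed.

Lemma bdd_cos (t : R) X :
  measurable_fun setT X -> bdd_measurable (fun x => cos (t * X x)).
Proof.
move=> mX; split; first exact: measurable_cosM.
by exists 1 => x; exact: cos_max.
Qed.

Lemma bdd_sin (t : R) X :
  measurable_fun setT X -> bdd_measurable (fun x => sin (t * X x)).
Proof.
move=> mX; split; first exact: measurable_sinM.
by exists 1 => x; exact: sin_max.
Qed.

Lemma Rintegral_cst1 P (c : R) : \int[P]_x c = c.
Proof. by rewrite Rintegral_cst// [X in fine X](probability_setT P) mulr1. Qed.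

Lemma le_bdd_Rintegral P f g : bdd_measurable f -> bdd_measurable g ->
  (forall x, f x <= g x) -> \int[P]_x f x <= \int[P]_x g x.
Proof. by move=> ? ? fg; apply: le_Rintegral => //; exact: bdd_integrable. Qed.

Lemma bdd_RintegralD P f g : bdd_measurable f -> bdd_measurable g ->
  \int[P]_x (f x + g x) = \int[P]_x f x + \int[P]_x g x.
Proof. by move=> ? ?; apply: RintegralD => //; exact: bdd_integrable. Qed.

Lemma bdd_RintegralB P f g : bdd_measurable f -> bdd_measurable g ->
  \int[P]_x (f x - g x) = \int[P]_x f x - \int[P]_x g x.
Proof. by move=> ? ?; apply: RintegralB => //; exact: bdd_integrable. Qed.

Lemma bdd_RintegralZ P f (c : R) : bdd_measurable f ->
  \int[P]_x (c * f x) = c * \int[P]_x f x.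
Proof. by move=> ?; apply: RintegralZl => //; exact: bdd_integrable. Qed.

Lemma norm_Rintegral_le P f : bdd_measurable f ->
  `|\int[P]_x f x| <= \int[P]_x `|f x|.
Proof. by move=> ?; apply: le_normr_Rintegral => //; exact: bdd_integrable. Qed.

Lemma bdd_norm f : bdd_measurable f -> bdd_measurable (fun x => `|f x|).
Proof.
move=> [mf [M Mf]]; split; first exact: measurableT_comp.
by exists M => x; rewrite normr_id.
Qed.

Lemma bdd_indic (A : set T) : measurable A -> bdd_measurable (\1_A : T -> R).
Proof.
move=> mA; split; first exact: measurable_indic.
by exists 1 => z; rewrite indicE; case: (_ \in _); rewrite ?normr1 ?normr0.
Qed.

Lemma bdd_sum (I : Type) (r : seq I) (Q : pred I) (f : I -> T -> R) :
  (forall i, Q i -> bdd_measurable (f i)) ->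
  bdd_measurable (fun w => \sum_(i <- r | Q i) f i w).
Proof.
move=> bf; elim: r => [|i r IH].
  rewrite (_ : (fun w => _) = (fun=> 0)); first exact: bdd_cst.
  by apply/funext => w; rewrite big_nil.
rewrite (_ : (fun w => _) =
    (fun w => (if Q i then f i w else 0) + \sum_(j <- r | Q j) f j w)).
  by apply: bddD => //; case: (boolP (Q i)) => [/bf//|_]; exact: bdd_cst.
by apply/funext => w; rewrite big_cons; case: ifP => // _; rewrite add0r.
Qed.

Lemma Rintegral_indic P (A : set T) : measurable A -> \int[P]_w \1_A w = fine (P A).
Proof. by move=> mA; rewrite /Rintegral integral_indic// setIT. Qed.

Lemma Rintegral_indicM P f (B : set T) :
  \int[P]_w (f w * \1_B w) = \int[P]_(w in B) f w.
Proof.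
rewrite [RHS]Rintegral_mkcond; apply: eq_Rintegral => w _.
by rewrite patchE indicE; case: ifP; rewrite ?mulr1 ?mulr0.
Qed.

Lemma bdd_Rintegral_sum P (I : Type) (r : seq I) (Q : pred I) (f : I -> T -> R) :
  (forall i, Q i -> bdd_measurable (f i)) ->
  \int[P]_w (\sum_(i <- r | Q i) f i w) = \sum_(i <- r | Q i) \int[P]_w f i w.
Proof.
move=> bf; elim: r => [|i r IH].
  by rewrite big_nil; under eq_Rintegral do rewrite big_nil; rewrite Rintegral_cst1.
rewrite big_cons; under eq_Rintegral do rewrite big_cons.
case: ifPn => // Qi.
by rewrite bdd_RintegralD ?IH//; [exact: bf|exact: bdd_sum].
Qed.

(* The squared modulus of the characteristic function of [X]. *)
Definition sqchf P X (t : R) : R :=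
  (\int[P]_x cos (t * X x)) ^+ 2 + (\int[P]_x sin (t * X x)) ^+ 2.

(** The shift [b] rotates the vector of the two integrals by the angle [t * b], and its length does
    not change. This removes all centerings. *)
Lemma sqchf_affine P X (c b t : R) : measurable_fun setT X ->
  sqchf P (fun x => c * X x + b) t = sqchf P X (t * c).
Proof.
move=> mX; rewrite /sqchf.
have C := bdd_cos (t * c) mX; have S := bdd_sin (t * c) mX.
set u := \int[P]_x cos (t * c * X x); set v := \int[P]_x sin (t * c * X x).
have -> : \int[P]_x cos (t * (c * X x + b)) = cos (t * b) * u - sin (t * b) * v.
  rewrite -!bdd_RintegralZ// -bdd_RintegralB;
      [|exact: (bddM (bdd_cst _))|exact: (bddM (bdd_cst _))].
  apply: eq_Rintegral => x _.
  by rewrite mulrDr mulrA cosD [cos _ * _]mulrC [sin _ * _]mulrC.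
have -> : \int[P]_x sin (t * (c * X x + b)) = cos (t * b) * v + sin (t * b) * u.
  rewrite -!bdd_RintegralZ// -bdd_RintegralD;
      [|exact: (bddM (bdd_cst _))|exact: (bddM (bdd_cst _))].
  apply: eq_Rintegral => x _.
  by rewrite mulrDr mulrA sinD [cos _ * sin (t * b)]mulrC [sin _ * cos _]mulrC.
have := cos2Dsin2 (t * b); set p := cos _; set q := sin _ => e.
transitivity ((p ^+ 2 + q ^+ 2) * (u ^+ 2 + v ^+ 2)); first by ring.
by rewrite e mul1r.
Qed.

Definition independent2 P X Y := forall A B : set R,
  measurable A -> measurable B ->
  P (X @^-1` A `&` Y @^-1` B) = (P (X @^-1` A) * P (Y @^-1` B))%E.
End bdd_measurable.

Lemma bdd_comp d (T : measurableType d) d' (T' : measurableType d')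
    (R : realType) (f : T -> R) (X : T' -> T) :
  bdd_measurable f -> measurable_fun setT X -> bdd_measurable (f \o X).
Proof.
move=> [mf [M Mf]] mX; split; first exact: measurableT_comp.
by exists M => x /=.
Qed.

Lemma Rintegral_distribution d (T : measurableType d) d' (T' : measurableType d')
    (R : realType) (P : probability T R) (X : {RV P >-> T'}) (f : T' -> R) :
  bdd_measurable f -> \int[distribution P X]_y f y = \int[P]_x f (X x).
Proof.
move=> bf; rewrite /Rintegral integral_distribution//.
  by apply/measurable_EFinP; case: bf.
by apply: bdd_integrable; exact: bdd_comp.
Qed.

Lemma Rintegral_prod_measure d1 (T1 : measurableType d1) d2
    (T2 : measurableType d2) (R : realType) (P : probability T1 R)
    (Q : probability T2 R) (f : T1 -> R) (g : T2 -> R) :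
  bdd_measurable f -> bdd_measurable g ->
  \int[(P \x Q)%E]_z (f z.1 * g z.2) = \int[P]_x f x * \int[Q]_y g y.
Proof.
move=> bf bg; have ig := bdd_integrable Q bg.
rewrite {1}/Rintegral -(integral12_prod_meas1 (m1 := P) (m2 := Q)); last first.
  apply: (bdd_integrable (P \x Q)%E (f := fun z => f z.1 * g z.2)).
  apply: bddM; first exact: (bdd_comp bf measurable_fst).
  exact: (bdd_comp bg measurable_snd).
rewrite (_ : (fun x => _) = EFin \o (fun x => f x * \int[Q]_y g y)); last first.
  apply/funext => x; rewrite /fubini_F /= EFinM.
  under eq_integral do rewrite EFinM.
  by rewrite integralZl// /Rintegral fineK//; exact: integrable_fin_num.
by rewrite -RintegralZr//; exact: bdd_integrable.
Qed.

Section independent2.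
Context d (T : measurableType d) (R : realType) (P : probability T R).

Lemma distribution_pair (X Y : {RV P >-> R}) : independent2 P X Y ->
  exists2 Z : {RV P >-> (R * R)%type}, (forall x, Z x = (X x, Y x)) &
  forall A, measurable A ->
    distribution P Z A = (distribution P X \x distribution P Y)%E A.
Proof.
move=> XY.
have mZ : measurable_fun setT (fun x => (X x, Y x)) by exact: measurable_fun_pair.
exists (mfun_Sub (mem_set mZ)) => // A mA.
rewrite (product_measure_unique (m' := distribution P (mfun_Sub (mem_set mZ))))//.
Qed.

Lemma Rintegral_independent2 (X Y : {RV P >-> R}) (f g : R -> R) :
  independent2 P X Y -> bdd_measurable f -> bdd_measurable g ->
  \int[P]_x (f (X x) * g (Y x)) = \int[P]_x f (X x) * \int[P]_x g (Y x).
Proof.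
move=> /distribution_pair[Z ZE XYE] bf bg.
rewrite -!Rintegral_distribution//; rewrite -Rintegral_prod_measure//.
transitivity (\int[distribution P Z]_z (f z.1 * g z.2)).
  rewrite Rintegral_distribution; first by apply: eq_Rintegral => x _; rewrite ZE.
  apply: bddM; first exact: (bdd_comp bf measurable_fst).
  exact: (bdd_comp bg measurable_snd).
by congr fine; apply: eq_measure_integral => A mA _; exact: XYE.
Qed.

Lemma ge0_integral_independent2 (X Y : {RV P >-> R}) (f g : R -> R) :
  independent2 P X Y -> measurable_fun setT f -> measurable_fun setT g ->
  (forall x, 0 <= f x) -> (forall x, 0 <= g x) ->
  (\int[P]_x (f (X x) * g (Y x))%:E =
   \int[P]_x (f (X x))%:E * \int[P]_x (g (Y x))%:E)%E.
Proof.
move=> /distribution_pair[Z ZE XYE] mf mg f0 g0.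
transitivity (\int[distribution P Z]_z (f z.1 * g z.2)%:E)%E.
  rewrite ge0_integral_distribution//.
  - by apply: eq_integral => x _ /=; rewrite ZE.
  - apply/measurable_EFinP; apply: measurable_funM.
      exact: (measurableT_comp mf measurable_fst).
    exact: (measurableT_comp mg measurable_snd).
  - by move=> z; rewrite lee_fin mulr_ge0.
rewrite (eq_measure_integral (distribution P X \x distribution P Y)%E); last first.
  by move=> A mA _; exact: XYE.
rewrite fubini_tonelli1; last 2 first.
- apply/measurable_EFinP; apply: measurable_funM.
    exact: (measurableT_comp mf measurable_fst).
  exact: (measurableT_comp mg measurable_snd).
- by move=> z; rewrite lee_fin mulr_ge0.
rewrite /fubini_F /=.
under eq_integral => x _.
  under eq_integral do rewrite EFinM.
  rewrite ge0_integralZl//; last 3 first.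
  - exact/measurable_EFinP.
  - by move=> y _; rewrite lee_fin.
  - by rewrite lee_fin.
  over.
rewrite ge0_integralZr//; last 3 first.
- exact/measurable_EFinP.
- by move=> y _; rewrite lee_fin.
- by apply: integral_ge0 => y _; rewrite lee_fin.
rewrite !ge0_integral_distribution//; try exact/measurable_EFinP;
  by move=> y; rewrite lee_fin.
Qed.

(** The addition formulas and independence reduce this to the two-square identity, that is, to the
    multiplicativity of the complex modulus. *)
Lemma sqchf_independentD (X Y : {RV P >-> R}) (t : R) : independent2 P X Y ->
  sqchf P (fun x => X x + Y x) t = sqchf P X t * sqchf P Y t.
Proof.
move=> XY; rewrite /sqchf.
have bc : bdd_measurable (fun x : R => cos (t * x)) by apply: bdd_cos; exact: measurable_id.
have bs : bdd_measurable (fun x : R => sin (t * x)) by apply: bdd_sin; exact: measurable_id.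
have bXY (f g : R -> R) : bdd_measurable f -> bdd_measurable g ->
    bdd_measurable (fun x => f (X x) * g (Y x)).
  by move=> bf bg; apply: bddM; [exact: (bdd_comp bf)|exact: (bdd_comp bg)].
have -> : \int[P]_x cos (t * (X x + Y x)) =
    \int[P]_x cos (t * X x) * \int[P]_x cos (t * Y x) -
    \int[P]_x sin (t * X x) * \int[P]_x sin (t * Y x).
  rewrite -(Rintegral_independent2 XY bc bc) -(Rintegral_independent2 XY bs bs).
  rewrite -bdd_RintegralB; [|exact: (bXY _ _ bc bc)|exact: (bXY _ _ bs bs)].
  by apply: eq_Rintegral => x _; rewrite mulrDr cosD.
have -> : \int[P]_x sin (t * (X x + Y x)) =
    \int[P]_x sin (t * X x) * \int[P]_x cos (t * Y x) +
    \int[P]_x cos (t * X x) * \int[P]_x sin (t * Y x).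
  rewrite -(Rintegral_independent2 XY bs bc) -(Rintegral_independent2 XY bc bs).
  rewrite -bdd_RintegralD; [|exact: (bXY _ _ bs bc)|exact: (bXY _ _ bc bs)].
  by apply: eq_Rintegral => x _; rewrite mulrDr sinD.
ring.
Qed.

End independent2.

Lemma sqchf_distribution d (T : measurableType d) (R : realType)
    (P : probability T R) (X : {RV P >-> R}) (t : R) :
  sqchf (distribution P X) id t = sqchf P X t.
Proof.
rewrite /sqchf !Rintegral_distribution//.
  by apply: (bdd_sin t); exact: measurable_id.
by apply: (bdd_cos t); exact: measurable_id.
Qed.

Lemma eq_sqchf (R : realType) (mu nu : probability R R) (t : R) :
  (forall A, measurable A -> mu A = nu A) -> sqchf mu id t = sqchf nu id t.
Proof.
move=> e; rewrite /sqchf /Rintegral.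
by congr (fine _ ^+ 2 + fine _ ^+ 2); apply: eq_measure_integral => A mA _; exact: e.
Qed.

Lemma sqchf_convolution (R : realType) (mu nu : probability R R) (t : R) :
  sqchf (convolution mu nu) id t = sqchf mu id t * sqchf nu id t.
Proof.
rewrite /convolution sqchf_distribution.
have [mf ms] : measurable_fun setT (@fst R R) /\ measurable_fun setT (@snd R R).
  by split; [exact: measurable_fst|exact: measurable_snd].
pose X : {RV (mu \x nu)%E >-> R} := mfun_Sub (mem_set mf).
pose Y : {RV (mu \x nu)%E >-> R} := mfun_Sub (mem_set ms).
have Xd A : measurable A -> distribution (mu \x nu)%E X A = mu A.
  move=> mA; rewrite /distribution /pushforward /= -setXT product_measure1E//.
  by rewrite [X in (_ * X)%E](probability_setT nu) mule1.
have Yd A : measurable A -> distribution (mu \x nu)%E Y A = nu A.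
  move=> mA; rewrite /distribution /pushforward /= -setTX product_measure1E//.
  by rewrite [X in (X * _)%E](probability_setT mu) mul1e.
rewrite -(eq_sqchf t Xd) -(eq_sqchf t Yd) !sqchf_distribution.
rewrite -(@sqchf_independentD _ _ _ _ X Y)//.
move=> A B mA mB; rewrite -[P in P = _]/((mu \x nu)%E (A `*` B)).
rewrite product_measure1E//.
by congr (_ * _)%E; [exact/esym/Xd|exact/esym/Yd].
Qed.

Lemma sqchf_convolution_power (R : realType) (mu : probability R R) k (t : R) :
  sqchf (convolution_power mu k) id t = sqchf mu id t ^+ k.
Proof.
elim: k => [|k IH]; last by rewrite /= sqchf_convolution IH exprS.
rewrite /sqchf /= /Rintegral !integral_dirac// ?diracT ?mul1e /=.
- by rewrite mulr0 cos0 sin0 expr1n expr0n addr0 expr0.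
- by apply/measurable_EFinP; apply: measurable_sinM; exact: measurable_id.
- by apply/measurable_EFinP; apply: measurable_cosM; exact: measurable_id.
Qed.

Lemma stable_sqchf (R : realType) (al : R) (F : probability R R) k (t : R) :
  stable_law al F -> (0 < k)%N ->
  sqchf F id t ^+ k = sqchf F id (k%:R `^ al^-1 * t).
Proof.
move=> [_ /(_ k)] + k0 => /(_ k0)[b Hb].
have mf : measurable_fun setT (fun x : R => k%:R `^ al^-1 * x + b).
  by apply: measurable_funD => //; apply: measurable_funM.
rewrite -sqchf_convolution_power.
rewrite (@eq_sqchf _ _ (distribution F (mfun_Sub (mem_set mf))))//.
rewrite sqchf_distribution mulrC -(sqchf_affine _ _ b)//.
Qed.

(** * Weak convergence and symmetrisation *)

(* Bounded and continuous, hence a test function, and small when [dl] is: this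
   gives both tightness and equicontinuity of the characteristic functions. *)
Definition clip1 (R : realType) (dl x : R) : R := Num.min 1 (dl * `|x|).

Section clip1.
Context {R : realType}.
Implicit Types (dl x y : R).

Lemma clip1_ge0 dl x : 0 <= dl -> 0 <= clip1 dl x.
Proof. by move=> dl0; rewrite le_min ler01 mulr_ge0. Qed.

Lemma clip1_le1 dl x : clip1 dl x <= 1.
Proof. by rewrite ge_min lexx. Qed.

Lemma continuous_clip1 dl : continuous (clip1 dl).
Proof.
move=> x; apply: (@continuous_min R _ (fun=> 1) (fun y => dl * `|y|)); first exact: cvg_cst.
by apply: cvgM; [exact: cvg_cst|exact: norm_continuous].
Qed.

Lemma norm_clip1_le1 dl x : 0 <= dl -> `|clip1 dl x| <= 1.
Proof. by move=> dl0; rewrite ger0_norm ?clip1_le1 ?clip1_ge0. Qed.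

Lemma bdd_clip1 dl d (T : measurableType d) (X : T -> R) : 0 <= dl ->
  measurable_fun setT X -> bdd_measurable (fun w => clip1 dl (X w)).
Proof.
move=> dl0 mX; split; last by exists 1 => w; exact: norm_clip1_le1.
apply: (measurableT_comp _ mX).
by apply: continuous_measurable_fun; exact: continuous_clip1.
Qed.

Lemma min2_clip1 dl x y : 0 <= dl -> y <= dl * `|x| -> y <= 2 -> y <= 2 * clip1 dl x.
Proof.
move=> dl0 y1 y2; have : 0 <= dl * `|x| by rewrite mulr_ge0.
by rewrite /clip1 /Num.min; case: ifP => _; lra.
Qed.

(** Dominated convergence along [dl = n.+1%:R^-1]. *)
Lemma clip1_integral_small (F : probability R R) (e : R) : 0 < e ->
  exists2 dl : R, 0 < dl & \int[F]_x clip1 dl x <= e.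
Proof.
move=> e0.
have mf n : measurable_fun [set: R] (fun x => (clip1 n.+1%:R^-1 x)%:E).
  apply/measurable_EFinP.
  by apply: continuous_measurable_fun; exact: continuous_clip1.
have f0 x : (clip1 n.+1%:R^-1 x)%:E @[n --> \oo] --> (0%R : R)%:E.
  apply: cvg_EFin; first by apply: nearW.
  apply: (@squeeze_cvgr _ _ _ _ (fun=> 0) (fun n => n.+1%:R^-1 * `|x|)).
  - by apply: nearW => n; rewrite clip1_ge0//= /clip1 ge_min lexx orbT.
  - exact: cvg_cst.
  - rewrite -(mul0r `|x|); apply: cvgM; last exact: cvg_cst.
    exact: cvg_harmonic.
have [//||||_ _] := @dominated_convergence _ _ _ F setT measurableT
  (fun n x => (clip1 n.+1%:R^-1 x)%:E) (cst 0%E) (cst 1%E) mf.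
- by apply: aeW => x _; exact: f0.
- by apply: (bdd_integrable F); exact: bdd_cst.
- apply: aeW => x n _; rewrite lee_fin; exact: norm_clip1_le1.
rewrite integral_cst// mul0e => /fine_cvgP[_] /cvgrPdist_le /(_ e e0)[n _ Hn].
exists n.+1%:R^-1; first by rewrite invr_gt0.
have := Hn n (leqnn n); rewrite /= sub0r normrN; apply: le_trans.
exact: ler_norm.
Qed.

End clip1.

Section weak_convergence.
Context d (T : measurableType d) (R : realType) (P : probability T R).
Context (X : nat -> T -> R) (F : probability R R).
Context (mX : forall n, measurable_fun setT (X n)).
Context (XF : cvg_in_distribution P X F).

Lemma cvg_in_distribution_Rintegral (f : R -> R) : continuous f ->
  (exists M : R, forall x, `|f x| <= M) ->
  \int[P]_w f (X n w) @[n --> \oo] --> \int[F]_x f x.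
Proof.
move=> cf bf; apply: fine_cvg; have := XF cf bf.
rewrite /Rintegral unlock fineK//; apply: integrable_fin_num => //.
by apply: bdd_integrable; split => //; exact: continuous_measurable_fun.
Qed.

Lemma clip1_tight (e : R) : 0 < e -> exists2 dl : R, 0 < dl &
  \forall n \near \oo, \int[P]_w clip1 dl (X n w) <= e.
Proof.
move=> e0; have e20 : 0 < e / 2 by rewrite divr_gt0.
have [dl dl0 Hdl] := clip1_integral_small F e20; exists dl => //.
have : \int[P]_w clip1 dl (X n w) @[n --> \oo] --> \int[F]_x clip1 dl x.
  apply: cvg_in_distribution_Rintegral; first exact: continuous_clip1.
  by exists 1 => x; exact: norm_clip1_le1 (ltW dl0).
move=> /cvgrPdist_le/(_ _ e20)[N _ HN]; exists N => // n Nn.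
have := HN n Nn; rewrite distrC => /ler_normlP[_].
by rewrite lerBlDr => /le_trans; apply; lra.
Qed.

Lemma sqchf_cvg (t : R) : sqchf P (X n) t @[n --> \oo] --> sqchf F id t.
Proof.
have cM : continuous (fun x : R => t * x) by move=> x; apply: cvgM;
    [exact: cvg_cst|exact: cvg_id].
have hc : \int[P]_w cos (t * X n w) @[n --> \oo] --> \int[F]_x cos (t * x).
  apply: (cvg_in_distribution_Rintegral (f := fun x => cos (t * x))).
    by move=> x; apply: continuous_comp; [exact: cM|exact: continuous_cos].
  by exists 1 => x; exact: cos_max.
have hs : \int[P]_w sin (t * X n w) @[n --> \oo] --> \int[F]_x sin (t * x).
  apply: (cvg_in_distribution_Rintegral (f := fun x => sin (t * x))).
    by move=> x; apply: continuous_comp; [exact: cM|exact: continuous_sin].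
  by exists 1 => x; exact: sin_max.
exact: cvgD (cvgM hc hc) (cvgM hs hs).
Qed.

End weak_convergence.

Section symmetrisation.
Context d (T : measurableType d) (R : realType) (P : probability T R).
Context (X : T -> R) (mX : measurable_fun setT X).

Let D (z : T * T) := X z.1 - X z.2.

Lemma measurable_symmetrised : measurable_fun setT D.
Proof.
apply: measurable_funB; first exact: (measurableT_comp mX measurable_fst).
exact: (measurableT_comp mX measurable_snd).
Qed.

(** The squared modulus is the characteristic function of the difference of two independent copies,
    which is real by symmetry. *)
Lemma sqchf_symmetrised (t : R) :
  sqchf P X t = \int[(P \x P)%E]_z cos (t * (X z.1 - X z.2)).
Proof.
have bc := bdd_cos t mX; have bs := bdd_sin t mX.
rewrite /sqchf !expr2 -!Rintegral_prod_measure// -bdd_RintegralD.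
- by apply: eq_Rintegral => z _; rewrite mulrBr cosB.
- by apply: bddM; [exact: (bdd_comp bc measurable_fst)|exact: (bdd_comp bc measurable_snd)].
- by apply: bddM; [exact: (bdd_comp bs measurable_fst)|exact: (bdd_comp bs measurable_snd)].
Qed.

Lemma sqchf_ge0 (t : R) : 0 <= sqchf P X t.
Proof. by rewrite addr_ge0// sqr_ge0. Qed.

Lemma sqchf_le1 (t : R) : sqchf P X t <= 1.
Proof.
rewrite sqchf_symmetrised -[leRHS](Rintegral_cst1 (P \x P)%E).
apply: le_bdd_Rintegral; [exact: bdd_cos measurable_symmetrised|exact: bdd_cst|].
by move=> z; exact: cos_le1.
Qed.

(** A modulus of continuity that sees [X] only through the integral of [clip1], hence uniform along
    a tight sequence. In the factored difference of squares the difference is at most [2 * I] and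
    the sum at most [2]; cosine and sine contribute [4] each. *)
Lemma sqchf_dist (dl s t : R) : 0 <= dl -> `|s - t| <= dl ->
  `|sqchf P X s - sqchf P X t| <= 8 * \int[P]_w clip1 dl (X w).
Proof.
move=> dl0 st; set I := \int[P]_w _.
have bI := bdd_clip1 dl0 mX.
have key (f : R -> R) : (forall u v, `|f u - f v| <= `|u - v|) ->
    (forall u, `|f u| <= 1) -> (forall u, bdd_measurable (fun w => f (u * X w))) ->
    `|(\int[P]_w f (s * X w)) ^+ 2 - (\int[P]_w f (t * X w)) ^+ 2| <= 4 * I.
  move=> lf f1 bf.
  have i1 u : `|\int[P]_w f (u * X w)| <= 1.
    apply: le_trans (norm_Rintegral_le P (bf u)) _.
    rewrite -[leRHS](Rintegral_cst1 P).
    by apply: le_bdd_Rintegral => //; [exact: bdd_norm|exact: bdd_cst].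
  have i2 : `|\int[P]_w f (s * X w) - \int[P]_w f (t * X w)| <= 2 * I.
    rewrite -bdd_RintegralB//.
    have bB := bddB (bf s) (bf t).
    apply: le_trans (norm_Rintegral_le P bB) _.
    rewrite -bdd_RintegralZ//; apply: le_bdd_Rintegral.
    - exact: bdd_norm.
    - by apply: bddM => //; exact: bdd_cst.
    move=> w; apply: min2_clip1 => //.
      apply: le_trans (lf _ _) _.
      by rewrite -mulrBl normrM ler_wpM2r.
    by apply: le_trans (ler_normB _ _) _; have := f1 (s * X w); have := f1 (t * X w); lra.
  rewrite subr_sqr normrM.
  have i3 : `|\int[P]_w f (s * X w) + \int[P]_w f (t * X w)| <= 2.
    by apply: le_trans (ler_normD _ _) _; have := i1 s; have := i1 t; lra.
  apply: le_trans (ler_pM _ _ i2 i3) _ => //.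
  by rewrite le_eqVlt; apply/orP; left; apply/eqP; ring.
rewrite /sqchf opprD addrACA; apply: le_trans (ler_normD _ _) _.
have := key cos (@norm_cosB_le R) (@cos_max R) (fun u => bdd_cos u mX).
have := key sin (@norm_sinB_le R) (@sin_max R) (fun u => bdd_sin u mX).
lra.
Qed.

Lemma sqchf0 : sqchf P X 0 = 1.
Proof.
rewrite sqchf_symmetrised -[RHS](Rintegral_cst1 (P \x P)%E).
by apply: eq_Rintegral => z _; rewrite mul0r cos0.
Qed.

(** This is the function [Psi] of the regular variation argument: a monotone substitute for
    [1 - sqchf]. *)
Definition trunc_sqr (u : R) : R :=
  \int[(P \x P)%E]_z Num.min 1 ((u * (X z.1 - X z.2)) ^+ 2).

Lemma bdd_trunc_sqr (u : R) :
  bdd_measurable (fun z : T * T => Num.min 1 ((u * (X z.1 - X z.2)) ^+ 2)).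
Proof.
split.
  apply: measurable_minr => //; apply: measurable_funX.
  by apply: measurable_funM => //; exact: measurable_symmetrised.
exists 1 => z; rewrite ger0_norm ?ge_min ?lexx//.
by rewrite le_min ler01 sqr_ge0.
Qed.

Lemma le_trunc_sqr (u v : R) : 0 < u -> u <= v -> trunc_sqr u <= trunc_sqr v.
Proof.
move=> u0 uv; apply: le_bdd_Rintegral; [exact: bdd_trunc_sqr|exact: bdd_trunc_sqr|].
move=> z; rewrite le_min ge_min lexx/= ge_min; apply/orP; right.
rewrite !exprMn ler_wpM2r ?sqr_ge0// lerXn2r ?nnegrE//; first exact: ltW.
by rewrite ltW// (lt_le_trans u0).
Qed.

Lemma trunc_sqr_scale (l u : R) : 0 < l <= 1 -> 0 < u ->
  l ^+ 2 * trunc_sqr u <= trunc_sqr (l * u).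
Proof.
move=> /andP[l0 l1] u0.
have l2 : l ^+ 2 <= 1 by rewrite exprn_ile1// ltW.
rewrite -bdd_RintegralZ; last exact: bdd_trunc_sqr.
apply: le_bdd_Rintegral; [apply: bddM;
    [exact: bdd_cst|exact: bdd_trunc_sqr]|exact: bdd_trunc_sqr|].
move=> z; rewrite -mulrA [(l * _) ^+ 2]exprMn; set y := _ ^+ 2 in l2 *; set x := _ ^+ 2.
have x0 : 0 <= x by exact: sqr_ge0.
have y0 : 0 <= y by exact: sqr_ge0.
rewrite le_min; apply/andP; split.
  rewrite -[leRHS]mulr1; apply: ler_pM => //; last by rewrite ge_min lexx.
  by rewrite le_min ler01.
by rewrite ler_wpM2l// ge_min lexx orbT.
Qed.

Lemma onem_sqchfE (t : R) :
  1 - sqchf P X t = \int[(P \x P)%E]_z (1 - cos (t * (X z.1 - X z.2))).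
Proof.
rewrite sqchf_symmetrised -[in LHS](Rintegral_cst1 (P \x P)%E 1).
rewrite -bdd_RintegralB//; first exact: bdd_cst.
exact: bdd_cos measurable_symmetrised.
Qed.

Lemma onem_sqchf_le (t : R) : 1 - sqchf P X t <= 2 * trunc_sqr t.
Proof.
rewrite onem_sqchfE -bdd_RintegralZ; last exact: bdd_trunc_sqr.
apply: le_bdd_Rintegral.
- by apply: bddB; [exact: bdd_cst|exact: bdd_cos measurable_symmetrised].
- by apply: bddM; [exact: bdd_cst|exact: bdd_trunc_sqr].
move=> z; set y := t * _.
have := onem_cos_le_sqr y; have := cos_geN1 y; have := sqr_ge0 y.
by rewrite /Num.min; case: ifP => _; lra.
Qed.

End symmetrisation.

(* [uniform_prob] lives on [measurableTypeR R], whose display differs from that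
   of the Borel structure of [R]. *)
Definition idR (R : realType) : measurableTypeR R -> R := idfun.

HB.instance Definition _ (R : realType) :=
  isMeasurableFun.Build _ _ (measurableTypeR R) R (@idR R) (@measurable_id _ _ setT).

Definition unif01 (R : realType) : probability R R :=
  distribution (uniform_prob (@ltr01 R)) (@idR R).

Lemma integral_unif01 (R : realType) (f : R -> \bar R) :
  measurable_fun setT f -> (forall x, 0 <= f x)%E ->
  (\int[unif01 R]_x f x = \int[lebesgue_measure]_(x in `[0%R, 1%R]) f x)%E.
Proof.
move=> mf f0; rewrite ge0_integral_distribution// integral_uniform//.
by rewrite subr0 invr1 mul1e.
Qed.

(** * Averages over a uniform scale *)

Section uniform_average.
Context {R : realType}.
Local Notation U := (unif01 R).

Lemma Rintegral_uniform_onem_cos (y : R) : y != 0 ->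
  \int[U]_s (1 - cos (s * y)) = 1 - sin y / y.
Proof.
move=> y0.
pose F : R -> R := id \- y^-1 \*: (sin \o ( *%R y)).
have cc : continuous (fun s : R => 1 - cos (s * y)).
  move=> s; apply: cvgB; first exact: cvg_cst.
  apply: continuous_comp; last exact: continuous_cos.
  by apply: cvgM; [exact: cvg_id|exact: cvg_cst].
have cF : continuous F.
  move=> s; apply: cvgB; first exact: cvg_id.
  apply: cvgZr; apply: continuous_comp; last exact: continuous_sin.
  by apply: cvgM; [exact: cvg_cst|exact: cvg_id].
have dF (s : R) : is_derive s 1 F (1 - cos (s * y)).
  rewrite /F; apply: is_derive_eq.
  rewrite /GRing.scale/= [s * y]mulrC; congr (_ - _).
  by rewrite mulr1 mulrCA mulVf// mulr1.
rewrite /Rintegral integral_unif01; last 2 first.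
- by apply/measurable_EFinP; exact: continuous_measurable_fun.
- by move=> s; rewrite lee_fin subr_ge0 cos_le1.
rewrite (@continuous_FTC2 _ _ F)//.
- by rewrite /F/= /GRing.scale/= !mulr0 sin0 mulr0 mulr1 !subr0 mulrC.
- exact: continuous_subspaceT.
- split => [x _||].
  + by have [] := dF x.
  + by apply: cvg_at_right_filter; exact: cF.
  + by apply: cvg_at_left_filter; exact: cF.
- by move=> x _; rewrite derive1E; have [] := dF x.
Qed.

(** For [|y| <= 2] the first term suffices, by [onem_cos_ge_sqr]. For larger [|y|] it may vanish,
    but then [sin y / y <= 1 / 2], so the average is at least [1 / 2]. *)
Lemma min1_sqr_le (y : R) : Num.min 1 (y ^+ 2) <=
  2 / cos 1 ^+ 2 * (1 - cos y) + 2 * \int[U]_s (1 - cos (s * y)).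
Proof.
have k0 : 0 < cos (1 : R) ^+ 2 by rewrite exprn_gt0// cos1_gt0.
have i0 : 0 <= \int[U]_s (1 - cos (s * y)).
  by apply: Rintegral_ge0 => s _; rewrite subr_ge0 cos_le1.
have [y2|y2] := leP `|y| 2.
  apply: (@le_trans _ _ (2 / cos 1 ^+ 2 * (1 - cos y))); last by rewrite lerDl mulr_ge0.
  rewrite ge_min; apply/orP; right.
  rewrite mulrAC ler_pdivlMr// -ler_pdivrMl//.
  by have := onem_cos_ge_sqr y2; lra.
have y0 : y != 0 by rewrite -normr_gt0; lra.
rewrite Rintegral_uniform_onem_cos//.
have : sin y / y <= 2^-1.
  apply: le_trans (ler_norm _) _; rewrite normrM normfV ler_pdivrMr ?normr_gt0//.
  by have := sin_max y; lra.
have : 0 <= 2 / cos 1 ^+ 2 * (1 - cos y).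
  by rewrite mulr_ge0 ?subr_ge0 ?cos_le1// divr_ge0// ltW.
by have : Num.min 1 (y ^+ 2) <= 1 by [rewrite ge_min lexx]; lra.
Qed.

End uniform_average.

(* Applying the library lemmas directly to a product such as [P \x P] makes
   unification diverge, hence the next two instances. *)
Lemma fubini_tonelli_prob d1 (T1 : measurableType d1) d2 (T2 : measurableType d2)
    (R : realType) (P : probability T1 R) (Q : probability T2 R)
    (f : T1 * T2 -> \bar R) :
  measurable_fun setT f -> (forall z, 0 <= f z)%E ->
  (\int[P]_x \int[Q]_y f (x, y) = \int[Q]_y fubini_G P f y)%E.
Proof. by move=> mf f0; exact: fubini_tonelli. Qed.

Lemma measurable_fubini_G_prob d1 (T1 : measurableType d1) d2 (T2 : measurableType d2)
    (R : realType) (P : probability T1 R) (Q : probability T2 R)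
    (f : T1 * T2 -> \bar R) :
  measurable_fun setT f -> (forall z, 0 <= f z)%E ->
  measurable_fun setT (fubini_G P f).
Proof. by move=> mf f0; exact: measurable_fun_fubini_tonelli_G. Qed.

Definition trunc_cst (R : realType) : R := 2 / cos 1 ^+ 2 + 2.

Lemma trunc_cst_gt0 (R : realType) : 0 < trunc_cst R.
Proof.
have k0 : 0 < cos (1 : R) ^+ 2 by rewrite exprn_gt0// cos1_gt0.
by rewrite addr_gt0// divr_gt0.
Qed.

(* Averaging [1 - cos (s y)] over [s] in [0, 1] bounds [min 1 (y ^ 2)], since
   the average of [cos (s y)] is [sin y / y]. *)
Lemma trunc_sqr_le d (T : measurableType d) (R : realType) (P : probability T R)
    (X : T -> R) (u B : R) : measurable_fun setT X ->
  (forall s : R, 0 <= s <= 1 -> 1 - sqchf P X (s * u) <= B) ->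
  trunc_sqr P X u <= trunc_cst R * B.
Proof.
move=> mX HB.
pose U := unif01 R.
pose D (z : T * T) := u * (X z.1 - X z.2).
have mD : measurable_fun setT D.
  by apply: measurable_funM => //; exact: measurable_symmetrised.
have mf : measurable_fun setT (fun zs : (T * T) * R => 1 - cos (zs.2 * D zs.1)).
  apply: measurable_funB => //; apply: measurableT_comp.
    by apply: continuous_measurable_fun; exact: continuous_cos.
  apply: measurable_funM; first exact: measurable_snd.
  exact: (measurableT_comp mD measurable_fst).
have f0 zs : (0%R <= (1 - cos (zs.2 * D zs.1))%:E)%E.
  by rewrite lee_fin subr_ge0 cos_le1.
have bf z : bdd_measurable (fun s : R => 1 - cos (s * D z)).
  apply: bddB; first exact: bdd_cst.
  split; last by exists 1 => s; exact: cos_max.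
  apply: measurableT_comp; first by apply: continuous_measurable_fun; exact: continuous_cos.
  exact: measurable_funM.
pose I z := \int[U]_s (1 - cos (s * D z)).
have IE z : (I z)%:E = (\int[U]_s (1 - cos (s * D z))%:E)%E.
  by rewrite /I /Rintegral fineK//; apply: integrable_fin_num => //; exact: bdd_integrable.
have mI : measurable_fun setT I.
  apply/measurable_EFinP;
      rewrite (_ : _ \o _ = fubini_F U (fun zs => (1 - cos (zs.2 * D zs.1))%:E)).
    by apply: measurable_fun_fubini_tonelli_F => //; exact/measurable_EFinP.
  by apply/funext => z; rewrite /= IE.
have bI : bdd_measurable I.
  split => //; exists 2 => z; rewrite ger0_norm; last first.
    by apply: Rintegral_ge0 => s _; rewrite subr_ge0 cos_le1.
  rewrite -[leRHS](Rintegral_cst1 U); apply: le_bdd_Rintegral => //; first exact: bdd_cst.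
  by move=> s; have := cos_geN1 (s * D z); lra.
have b1 : bdd_measurable (fun z => 1 - cos (D z)).
  apply: bddB; first exact: bdd_cst.
  exact: bdd_cos (measurable_symmetrised mX).
pose f zs : \bar R := (1 - cos (zs.2 * D zs.1))%:E.
have mf' : measurable_fun setT f by exact/measurable_EFinP.
have GE s : fubini_G (P \x P)%E f s = (1 - sqchf P X (s * u))%:E.
  rewrite onem_sqchfE// /Rintegral fineK; last first.
    apply: integrable_fin_num => //.
    apply: (bdd_integrable _ (f := fun z => 1 - cos (s * u * (X z.1 - X z.2)))).
    by apply: bddB; [exact: bdd_cst|exact: bdd_cos (measurable_symmetrised mX)].
  by apply: eq_integral => z _; rewrite /f /D /= mulrA.
have IB : \int[(P \x P)%E]_z I z <= B.
  have B0 : 0 <= B.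
    have h0 : 0 <= (0 : R) <= 1 by rewrite lexx ler01.
    by apply: le_trans (HB 0 h0); rewrite subr_ge0 sqchf_le1.
  rewrite -lee_fin /Rintegral fineK; last first.
    by apply: integrable_fin_num => //; exact: bdd_integrable.
  (* Tonelli: integrating over the pair first turns the inner integral into [1 - sqchf P X (s * u)],
     which is at most [B] for [s] in [[0, 1]]. *)
  have -> : (\int[(P \x P)%E]_z (I z)%:E =
      \int[U]_s fubini_G (P \x P)%E f s)%E.
    rewrite (eq_integral (fun z => \int[U]_s f (z, s))%E); last by move=> z _; rewrite IE.
    exact: (fubini_tonelli_prob (P \x P)%E U mf' f0).
  have mG : measurable_fun setT (fubini_G (P \x P)%E f).
    exact: (measurable_fubini_G_prob (P \x P)%E U mf' f0).
  have G0 s : (0 <= fubini_G (P \x P)%E f s)%E.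
    by rewrite GE lee_fin subr_ge0 sqchf_le1.
  rewrite (integral_unif01 mG G0).
  apply: (@le_trans _ _ (\int[lebesgue_measure]_(s in `[0%R, 1%R]) B%:E)%E).
    apply: ge0_le_integral => //.
    - exact: measurable_funTS.
    - by move=> s; rewrite /= in_itv/= GE lee_fin; exact: HB.
  have e : (lebesgue_measure (`[0%R, 1%R]%classic : set R) = 1)%E.
    by rewrite lebesgue_measure_itv/= lte_fin ltr01 -EFinB subr0.
  by rewrite integral_cst// [X in (_ * X)%E]e mule1.
apply: (@le_trans _ _ (\int[(P \x P)%E]_z
    (2 / cos 1 ^+ 2 * (1 - cos (D z)) + 2 * I z))).
  apply: le_bdd_Rintegral; first exact: bdd_trunc_sqr.
    by apply: bddD; apply: bddM => //; exact: bdd_cst.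
  by move=> z; exact: min1_sqr_le.
rewrite bdd_RintegralD ?bdd_RintegralZ//; last 2 first.
- by apply: bddM => //; exact: bdd_cst.
- by apply: bddM => //; exact: bdd_cst.
rewrite /trunc_cst [leRHS]mulrDl; apply: lerD; last by rewrite ler_wpM2l.
rewrite ler_wpM2l ?divr_ge0 ?sqr_ge0//.
have h1 : 0 <= (1 : R) <= 1 by rewrite ler01 lexx.
have := HB 1 h1; rewrite mul1r onem_sqchfE//; apply: le_trans.
Qed.

(** * Normalisation of sums attracted to a stable law *)

Lemma probability_pos_exists (R : realType) (F : probability R R) (A : set R) :
  measurable A -> F A = 0%E -> exists x, ~ A x.
Proof.
move=> mA FA; apply/not_existsP => h.
suff : F setT = 0%E by move/eqP; rewrite [X in X == _](probability_setT F) onee_eq0.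
by rewrite (_ : setT = A)// eqEsubset; split => // x _; apply: contrapT; exact: h.
Qed.

(* The difference of two independent variables of law [F] then vanishes almost
   surely. *)
Lemma sqchf1_degenerate (R : realType) (F : probability R R) :
  (forall t : R, 0 < t -> sqchf F id t = 1) -> exists c, F [set c] = 1%E.
Proof.
move=> F1.
have mid : measurable_fun [set: R] id by exact: measurable_id.
have S0 : trunc_sqr F id 1 <= 0.
  rewrite -(mulr0 (trunc_cst R)); apply: trunc_sqr_le => // s /andP[s0 _].
  have [->|sn0] := eqVneq s 0; first by rewrite mul0r sqchf0// subrr.
  by rewrite F1 ?subrr// mulr1 lt0r sn0.
pose f (z : R * R) : R := Num.min 1 ((1 * (z.1 - z.2)) ^+ 2).
have bf : bdd_measurable f by exact: (bdd_trunc_sqr mid 1).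
have f0 z : 0 <= f z by rewrite le_min ler01 sqr_ge0.
pose f' z := (f z)%:E.
have mf' : measurable_fun setT f' by apply/measurable_EFinP; case: bf.
have f'0 z : (0 <= f' z)%E by rewrite lee_fin.
have I0 : (\int[(F \x F)%E]_z f' z = 0)%E.
  apply/eqP; rewrite eq_le; apply/andP; split; last by apply: integral_ge0 => z _;
      exact: f'0.
  move: S0; rewrite /trunc_sqr /Rintegral -lee_fin fineK//.
  by apply: integrable_fin_num => //; exact: bdd_integrable.
have I1 : (\int[F]_y fubini_G F f' y = 0)%E.
  by rewrite -(fubini_tonelli_prob F F mf' f'0) -I0 fubini_tonelli1.
have G0 y : (0 <= fubini_G F f' y)%E by apply: integral_ge0 => x _; exact: f'0.
have : ae_eq F setT (fubini_G F f') (cst 0%E).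
  apply/(ae_eq_integral_abs _ measurableT);
      first exact: (measurable_fubini_G_prob F F mf' f'0).
  by rewrite -[RHS]I1; apply: eq_integral => y _; rewrite gee0_abs.
move=> [N [mN FN0 HN]].
(* Almost every section of the double integral vanishes; any [c] with this property is the atom. *)
have [c Nc] := probability_pos_exists mN FN0.
have Gc : fubini_G F f' c = 0%E.
  by apply: contrapT => h; apply: Nc; apply: HN => /= /(_ I).
exists c.
have mfc : measurable_fun setT (fun x => f' (x, c)).
  apply: measurableT_comp => //; exact: measurable_fun_pair.
have : ae_eq F setT (fun x => f' (x, c)) (cst 0%E).
  apply/(ae_eq_integral_abs _ measurableT) => //.
  by rewrite -[RHS]Gc; apply: eq_integral => y _; rewrite gee0_abs.
move=> [M [mM FM0 HM]].
have mC : measurable (~` [set c] : set R) by apply: measurableC.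
have Fc : F (~` [set c]) = 0%E.
  apply/eqP; rewrite eq_le; apply/andP; split => //.
  rewrite -FM0; apply: le_measure; [exact: mem_set|exact: mem_set|].
  move=> x /= xc; apply: HM => /= /(_ I)[]; rewrite /f/= mul1r => h.
  have : 0 < Num.min 1 ((x - c) ^+ 2).
    rewrite lt_min ltr01 lt0r sqr_ge0 andbT sqrf_eq0 subr_eq0.
    exact/eqP.
  by rewrite h ltxx.
by have := probability_setC F mC; rewrite setCK Fc sube0.
Qed.

(** * The truncated second moment at the scale of [a n] *)

Section stable_bounds.
Context d (T : measurableType d) (R : realType) (P : probability T R).
Context (W : T -> R) (mW : measurable_fun setT W).
Context (X : nat -> T -> R) (mX : forall n, measurable_fun setT (X n)).
Context (F : probability R R) (al : R) (al0 : 0 < al) (stF : stable_law al F).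
Context (XF : cvg_in_distribution P X F).
Context (a : nat -> R) (a0 : forall n, (0 < n)%N -> 0 < a n).
Context (XE : forall n t, (0 < n)%N ->
  sqchf P (X n) t = sqchf P W (t / a n) ^+ n).

Let h := sqchf F id.
Let mid : measurable_fun [set: R] id := @measurable_id _ _ setT.
Let h0 t : 0 <= h t. Proof. exact: sqchf_ge0. Qed.
Let h1 t : h t <= 1. Proof. exact: sqchf_le1. Qed.

Let hk k t : (0 < k)%N -> h (k%:R `^ (- al^-1) * t) ^+ k = h t.
Proof.
move=> k0; rewrite /h (stable_sqchf _ stF)//; congr sqchf.
by rewrite mulrA powRN divff ?mul1r// gt_eqF// powR_gt0// ltr0n.
Qed.

Lemma stable_sqchf_near0 : exists2 dl : R, 0 < dl &
  forall s : R, 0 <= s <= dl -> 2^-1 <= h s.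
Proof.
(* [sqchf_dist] multiplies the integral by [8], and [8 / 16] is the drop allowed from [h 0 = 1]. *)
have e0 : 0 < (16 : R)^-1 by rewrite invr_gt0.
have [dl dl0 H] := clip1_integral_small F e0.
exists dl => // s /andP[s0 s1].
have := @sqchf_dist _ _ _ F id mid dl s 0 (ltW dl0).
rewrite subr0 ger0_norm// sqchf0// => /(_ s1) /ler_normlP[+ _].
rewrite -/(h s); lra.
Qed.

Lemma stable_sqchf_lt1 : exists2 t : R, 0 < t & h t < 1.
Proof.
apply: contrapT => H; have [ndF _] := stF.
have [t t0|c] := @sqchf1_degenerate _ F; last exact: ndF.
apply: le_anti; rewrite h1/= leNgt; apply/negP => ht.
by apply: H; exists t.
Qed.

(** By stability [h s ^+ k] is the value of [h] at [k ^ (1 / al) * s], a point of [[0, dl]], so it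
    is at least [1 / 2]; [expr_onem_le] then yields [k * (1 - h s) <= 1]. *)
Lemma stable_sqchf_scale (dl : R) k s : 0 < dl ->
  (forall s : R, 0 <= s <= dl -> 2^-1 <= h s) -> (0 < k)%N ->
  0 <= s <= k%:R `^ (- al^-1) * dl -> 1 - k%:R^-1 <= h s.
Proof.
move=> dl0 H k0 /andP[s0 sk].
have k0' : 0 < k%:R :> R by rewrite ltr0n.
have : 2^-1 <= h s ^+ k.
  pose t := k%:R `^ al^-1 * s.
  have -> : s = k%:R `^ (- al^-1) * t.
    by rewrite mulrA powRN mulVf ?mul1r// gt_eqF// powR_gt0.
  rewrite hk//; apply: H; rewrite /t mulr_ge0 ?powR_ge0//=.
  have := ler_wpM2l (powR_ge0 k%:R al^-1) sk.
  by rewrite mulrA powRN divff ?mul1r// gt_eqF// powR_gt0.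
have p01 : 0 <= 1 - h s <= 1 by rewrite subr_ge0 h1/= gerBl.
have := expr_onem_le k p01; rewrite opprB addrC subrK => e1 e2.
have : 1 + k%:R * (1 - h s) <= 2.
  have h3 : 0 <= 1 + k%:R * (1 - h s).
    by rewrite addr_ge0// mulr_ge0 ?subr_ge0// ltW.
  by have := ler_wpM2r h3 e2; lra.
rewrite -lerBrDl => e3; rewrite lerBlDr -lerBlDl -(ler_pM2l k0') divff ?gt_eqF//.
lra.
Qed.

(** [trunc_sqr_le] needs all [s] at once, while convergence is pointwise: a finite mesh of step at
    most [d1] and the modulus of continuity [sqchf_dist] bridge the gap. The loss [2 / k] consists
    of [1 / k] from the limit, [1 / (2 k)] from convergence on the mesh and [8 / (16 k)] from the
    passage to the mesh. *)
Lemma sqchf_uniform_lower (dl : R) k : 0 < dl ->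
  (forall s : R, 0 <= s <= dl -> 2^-1 <= h s) -> (0 < k)%N ->
  \forall n \near \oo, forall s : R, 0 <= s <= k%:R `^ (- al^-1) * dl ->
    1 - 2 / k%:R <= sqchf P (X n) s.
Proof.
move=> dl0 H k0; set tau := _ * dl.
have k0' : 0 < k%:R :> R by rewrite ltr0n.
have tau0 : 0 < tau by rewrite mulr_gt0// powR_gt0.
have e0 : 0 < (k%:R * 16 : R)^-1 by rewrite invr_gt0 mulr_gt0.
have [d1 d10 Hd] := clip1_tight XF e0.
pose M := (Num.truncn (tau / d1)).+1.
have M0 : 0 < M%:R :> R by rewrite ltr0n.
have Md : tau / M%:R <= d1.
  rewrite ler_pdivrMr// mulrC -ler_pdivrMr// ltW//; exact: truncnS_gt.
have e1 : 0 < (k%:R * 2 : R)^-1 by rewrite invr_gt0 mulr_gt0.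
have Hi : \forall n \near \oo, forall i : 'I_M.+1,
    `|h (i%:R * (tau / M%:R)) - sqchf P (X n) (i%:R * (tau / M%:R))| <= (k%:R * 2)^-1.
  apply: filter_forall => i.
  by have /cvgrPdist_le/(_ _ e1) := sqchf_cvg XF (t := i%:R * (tau / M%:R)).
near=> n => s /andP[s0 st].
pose i := Num.truncn (s / (tau / M%:R)).
have sM : 0 <= s / (tau / M%:R) by apply: divr_ge0 => //; apply/ltW/divr_gt0.
have /andP[i1 i2] := truncn_itv sM; rewrite -/i in i1 i2.
have mesh0 : 0 < tau / M%:R by rewrite divr_gt0.
have iM : (i < M.+1)%N.
  rewrite ltnS -(ler_nat R); apply: (le_trans i1).
  rewrite ler_pdivrMr// mulrCA divff ?gt_eqF// mulr1//.
rewrite ler_pdivlMr// in i1; rewrite ltr_pdivrMr// -natr1 mulrDl mul1r in i2.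
have st1 : `|s - i%:R * (tau / M%:R)| <= d1.
  rewrite ger0_norm ?subr_ge0//; apply: le_trans Md; rewrite lerBlDl; exact: ltW.
have d1' : 0 <= d1 by exact: ltW.
have D1 := @sqchf_dist _ _ _ P (X n) (mX n) d1 s (i%:R * (tau / M%:R)) d1' st1.
have D2 : \int[P]_w clip1 d1 (X n w) <= (k%:R * 16)^-1 by near: n; exact: Hd.
have D3 : `|h (i%:R * (tau / M%:R)) - sqchf P (X n) (i%:R * (tau / M%:R))| <= (k%:R * 2)^-1.
  suff D : forall j : 'I_M.+1,
      `|h (j%:R * (tau / M%:R)) - sqchf P (X n) (j%:R * (tau / M%:R))| <= (k%:R * 2)^-1.
    exact: (D (Ordinal iM)).
  by near: n; exact: Hi.
have D4 : 1 - k%:R^-1 <= h (i%:R * (tau / M%:R)).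
  apply: (stable_sqchf_scale dl0 H k0); rewrite mulr_ge0 ?(ltW mesh0)//=.
  exact: le_trans i1 st.
have k16 : (k%:R * 16 : R)^-1 = k%:R^-1 / 16 by rewrite invfM.
have k2 : (k%:R * 2 : R)^-1 = k%:R^-1 / 2 by rewrite invfM.
rewrite k16 in D2; rewrite k2 in D3.
move/ler_normlP: D1 => [D1 _]; move/ler_normlP: D3 => [_ D3].
have : 0 < k%:R^-1 :> R by rewrite invr_gt0.
lra.
Unshelve. all: by end_near. Qed.

(** For [p] the deficit of [sqchf P W] at [s * (tau / a n)], the uniform bound and [expr_onem_le]
    give [(1 - 2 / k) * (1 + n * p) <= 1]. As [k >= 4] makes the first factor at least [1 / 2], this
    is [n * p <= 4 / k]. *)
Lemma trunc_sqr_upper (dl : R) k : 0 < dl ->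
  (forall s : R, 0 <= s <= dl -> 2^-1 <= h s) -> (4 <= k)%N ->
  \forall n \near \oo,
    n%:R * trunc_sqr P W (k%:R `^ (- al^-1) * dl / a n) <= trunc_cst R * (4 / k%:R).
Proof.
move=> dl0 H k4; have k0 : (0 < k)%N by exact: leq_trans k4.
set tau := _ * dl.
have tau0 : 0 < tau by rewrite mulr_gt0// powR_gt0// ltr0n.
near=> n.
have n0 : (0 < n)%N by near: n; exact: nbhs_infty_gt.
have n0' : 0 < n%:R :> R by rewrite ltr0n.
have U : forall s : R, 0 <= s <= tau -> 1 - 2 / k%:R <= sqchf P (X n) s.
  by near: n; exact: sqchf_uniform_lower.
rewrite mulrC -ler_pdivlMr// -[leRHS]mulrA; apply: trunc_sqr_le => // s /andP[s0 s1].
set p := 1 - _.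
have p01 : 0 <= p <= 1 by rewrite /p subr_ge0 sqchf_le1// gerBl sqchf_ge0.
have := expr_onem_le n p01; rewrite /p opprB addrC subrK => e2; rewrite -/p in e2.
have e1 : 1 - 2 / k%:R <= sqchf P W (s * (tau / a n)) ^+ n.
  rewrite mulrA -XE//; apply: U; rewrite mulr_ge0 ?(ltW tau0)//=.
  by rewrite ler_piMl ?(ltW tau0).
have k4' : 4 <= k%:R :> R by rewrite (ler_nat R 4).
have kV : k%:R^-1 <= (4 : R)^-1 by rewrite lef_pV2 ?posrE//; lra.
have kV0 : 0 < k%:R^-1 :> R by rewrite invr_gt0; lra.
rewrite ler_pdivlMr// mulrC.
have np0 : 0 <= n%:R * p by rewrite mulr_ge0//; case/andP: p01.
have h3 : 0 <= 1 + n%:R * p by rewrite addr_ge0.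
have e3 := le_trans (ler_wpM2r h3 e1) e2.
have e4 : (1 - 2 / k%:R) * (1 + n%:R * p) =
    1 + n%:R * p - 2 * k%:R^-1 - 2 * (k%:R^-1 * (n%:R * p)) by ring.
have e5 : k%:R^-1 * (n%:R * p) <= 4^-1 * (n%:R * p) by rewrite ler_wpM2r.
rewrite e4 in e3; rewrite -/p.
lra.
Unshelve. all: by end_near. Qed.

(** Bernoulli's inequality is used for the [k]-th power given by stability and for the [n]-th power
    given by independence. Of the factor [1 / 4], one half pays for convergence at the single point
    [s] and one half for [onem_sqchf_le]. *)
Lemma trunc_sqr_lower (t : R) k : 0 < t -> h t < 1 -> (0 < k)%N ->
  \forall n \near \oo, (1 - h t) / 4 / k%:R <=
    n%:R * trunc_sqr P W (k%:R `^ (- al^-1) * t / a n).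
Proof.
move=> t0 ht k0; set s := _ * t.
have k0' : 0 < k%:R^-1 :> R by rewrite invr_gt0 ltr0n.
have hs01 : 0 <= 1 - h s <= 1 by rewrite subr_ge0 h1/= gerBl.
have q : (1 - h t) / k%:R <= 1 - h s.
  have := bernoulli_le k hs01; rewrite opprB [in X in _ <= X]addrC subrK /s hk//.
  by move=> e; rewrite ler_pdivrMr ?ltr0n//; lra.
have q0 : 0 < (1 - h t) / 2 / k%:R.
  by rewrite !divr_gt0 ?subr_gt0// ltr0n.
have /cvgrPdist_le/(_ _ q0) cv := sqchf_cvg XF (t := s).
near=> n.
have n0 : (0 < n)%N by near: n; exact: nbhs_infty_gt.
have c : `|sqchf F id s - sqchf P (X n) s| <= (1 - h t) / 2 / k%:R by near: n; exact: cv.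
move/ler_normlP: c => [c _]; rewrite XE// in c.
have g01 : 0 <= 1 - sqchf P W (s / a n) <=
    1 by rewrite subr_ge0 sqchf_le1// gerBl sqchf_ge0.
have := bernoulli_le n g01; rewrite opprB [in X in _ <= X]addrC subrK => b.
have := ler_wpM2l (ler0n R n) (onem_sqchf_le P mW (s / a n)) => b'.
have -> : (1 - h t) / 4 / k%:R = (1 - h t) / 2 / k%:R / 2.
  by rewrite (_ : 4 = 2 * 2) ?invfM//; ring.
have e : (1 - h t) / k%:R = 2 * ((1 - h t) / 2 / k%:R) by field; rewrite gt_eqF ?ltr0n.
rewrite -/(h s) in c; lra.
Unshelve. all: by end_near. Qed.

(** The preceding bounds hold at points proportional to [k ^ (- 1 / al)], where [1 / k] is of order
    [t ^ al]. Monotonicity of [trunc_sqr] reaches the other [t], and rounding to an integer costs a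
    factor [2]. *)
Lemma trunc_sqr_bounds : exists t0 c1 c2 : R, [/\ 0 < t0, 0 < c1, 0 < c2 &
  forall t : R, 0 < t <= t0 -> \forall n \near \oo,
  c1 * t `^ al <= n%:R * trunc_sqr P W (t / a n) <= c2 * t `^ al].
Proof.
have [dl dl0 H] := stable_sqchf_near0.
have [t1 t10 ht1] := stable_sqchf_lt1.
pose q := (1 - h t1) / 4.
have q0 : 0 < q by rewrite divr_gt0// subr_gt0.
have C0 := trunc_cst_gt0 R.
(* The first bound ensures [k >= 4] below, the second [1 <= (t1 / t) ^ al], hence
   [m <= 2 * (t1 / t) ^ al]. *)
pose t0 := Num.min (4 `^ (- al^-1) * dl) t1.
have t00 : 0 < t0 by rewrite lt_min t10 andbT mulr_gt0// powR_gt0.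
exists t0, (q / 2 / t1 `^ al), (trunc_cst R * 8 / dl `^ al); split => //.
- by rewrite divr_gt0 ?powR_gt0// divr_gt0.
- by rewrite divr_gt0 ?powR_gt0// mulr_gt0.
move=> t /andP[tgt0]; rewrite le_min => /andP[t4 tt1].
have sc1 (r k : R) : 0 < r -> 0 < k -> k <= (r / t) `^ al -> t <= k `^ (- al^-1) * r.
  move=> r0 k0 kr; rewrite powRN mulrC ler_pdivlMr ?powR_gt0// mulrC -ler_pdivlMr//.
  have rt : 0 <= r / t by rewrite divr_ge0// ltW.
  have -> : r / t = (r / t) `^ al `^ al^-1 by rewrite -powRrM divff ?gt_eqF// powRr1.
  by rewrite ge0_ler_powR ?nnegrE ?powR_ge0 ?(ltW k0)// invr_ge0 ltW.
have sc2 (r k : R) : 0 < r -> 0 < k -> (r / t) `^ al <= k -> k `^ (- al^-1) * r <= t.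
  move=> r0 k0 kr; rewrite powRN mulrC ler_pdivrMr ?powR_gt0// mulrC -ler_pdivrMr//.
  have rt : 0 <= r / t by rewrite divr_ge0// ltW.
  have -> : r / t = (r / t) `^ al `^ al^-1 by rewrite -powRrM divff ?gt_eqF// powRr1.
  by rewrite ge0_ler_powR ?nnegrE ?powR_ge0 ?(ltW k0)// invr_ge0 ltW.
have powV (r : R) : 0 < r -> (r / t) `^ al = r `^ al / t `^ al.
  move=> r0; rewrite powRM ?invr_ge0 ?(ltW r0) ?(ltW tgt0)//; congr (_ * _).
  by rewrite -powR_inv1 ?(ltW tgt0)// -powRrM mulN1r powRN.
have tal : 0 < t `^ al by rewrite powR_gt0.
(* [k] is rounded down so that its sample point lies above [t], and [m] is rounded up so that its
   sample point lies below. *)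
pose k := Num.truncn ((dl / t) `^ al).
have y0 : 0 <= (dl / t) `^ al by exact: powR_ge0.
have /andP[k1 k2] := truncn_itv y0; rewrite -/k in k1 k2.
have k4 : (4 <= k)%N.
  rewrite /k truncn_ge_nat//.
  have : t * 4 `^ al^-1 <= dl.
    by move: t4; rewrite powRN mulrC ler_pdivlMr ?powR_gt0.
  rewrite mulrC -ler_pdivlMr// => h4.
  have -> : 4%:R = (4 `^ al^-1) `^ al :> R by rewrite -powRrM mulVf ?gt_eqF// powRr1.
  by rewrite ge0_ler_powR ?nnegrE ?powR_ge0 ?(ltW al0)// divr_ge0 ?ltW.
have k0 : 0 < k%:R :> R by rewrite ltr0n (leq_trans _ k4).
pose m := (Num.truncn ((t1 / t) `^ al)).+1.
have z0 : 0 <= (t1 / t) `^ al by exact: powR_ge0.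
have /andP[m1 m2] := truncn_itv z0; rewrite -/m in m2.
have m0 : 0 < m%:R :> R by rewrite ltr0n.
have z1 : 1 <= (t1 / t) `^ al.
  have := @ge0_ler_powR _ al (ltW al0) 1 (t1 / t); rewrite powR1 !nnegrE.
  by apply; rewrite ?ler01 ?divr_ge0 ?(ltW t10) ?(ltW tgt0)// ler_pdivlMr// mul1r.
have m2' : m%:R <= 2 * (t1 / t) `^ al by rewrite /m -natr1; lra.
have k2' : (dl / t) `^ al <= 2 * k%:R.
  by apply: (le_trans (ltW k2)); rewrite -natr1; have : 1 <= k%:R :> R;
      [rewrite ler1n (leq_trans _ k4)|lra].
near=> n.
have n0 : (0 < n)%N by near: n; exact: nbhs_infty_gt.
have n0' : 0 < n%:R :> R by rewrite ltr0n.
have an0 := a0 n0.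
apply/andP; split.
  have : q / m%:R <= n%:R * trunc_sqr P W (m%:R `^ (- al^-1) * t1 / a n).
    by near: n; exact: trunc_sqr_lower.
  move=> e; apply: (@le_trans _ _ (q / m%:R)).
    rewrite powV// in m2'.
    rewrite ler_pdivlMr//.
    have : q / 2 / t1 `^ al * t `^ al * m%:R <=
        q / 2 / t1 `^ al * t `^ al * (2 * (t1 `^ al / t `^ al)).
      apply: ler_wpM2l => //; apply/ltW/mulr_gt0 => //.
      by apply: divr_gt0; [exact: divr_gt0|exact: powR_gt0].
    rewrite [leRHS](_ : _ = q)//.
    by field; rewrite !gt_eqF ?powR_gt0.
  apply: (le_trans e); rewrite ler_pM2l//; apply: le_trunc_sqr => //.
    by rewrite divr_gt0// mulr_gt0// powR_gt0.
  by rewrite ler_pM2r ?invr_gt0//; apply: sc2 => //; exact: ltW.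
have : n%:R * trunc_sqr P W (k%:R `^ (- al^-1) * dl / a n) <= trunc_cst R * (4 / k%:R).
  by near: n; exact: trunc_sqr_upper.
move=> e; apply: (@le_trans _ _ (trunc_cst R * (4 / k%:R))); last first.
  rewrite powV// in k2'.
  rewrite mulrA ler_pdivrMr//.
  have : trunc_cst R * 8 / dl `^ al * t `^ al * (dl `^ al / t `^ al) <=
      trunc_cst R * 8 / dl `^ al * t `^ al * (2 * k%:R).
    apply: ler_wpM2l => //; apply/ltW/mulr_gt0 => //.
    by apply: divr_gt0; [exact: mulr_gt0|exact: powR_gt0].
  rewrite [leLHS](_ : _ = trunc_cst R * 8); last by field; rewrite !gt_eqF ?powR_gt0.
  by rewrite mulrCA -[leLHS]mulr1; lra.
apply: le_trans e; rewrite ler_pM2l//; apply: le_trunc_sqr => //.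
  by rewrite divr_gt0.
by rewrite ler_pM2r ?invr_gt0//; exact: sc1.
Unshelve. all: by end_near. Qed.

End stable_bounds.

(** * Partial sums *)

Section partial_sums.
Context d (T : measurableType d) (R : realType) (P : probability T R).
Context (Ws : nat -> {RV P >-> R}) (indep : mutually_independent Ws).

Let cyl (J : {fset nat}) (B : nat -> set R) : set T :=
  \bigcap_(i in [set` J]) (Ws i @^-1` B i).

Lemma measurable_partial_sum n :
  measurable_fun setT (fun w => \sum_(i < n) Ws i w).
Proof. by apply: measurable_sum => i. Qed.

Let S n : {RV P >-> R} := mfun_Sub (mem_set (measurable_partial_sum n)).

Let measurable_cyl J B : (forall i, i \in J -> measurable (B i)) ->
  measurable (cyl J B).
Proof.
move=> mB; apply: fin_bigcap_measurable; first exact: finite_fset.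
by move=> i /= iJ; apply: measurable_funPTI => //; exact: mB.
Qed.

(* On the event [cyl J B], the law of [(S_k, W_k)] and the product of the
   marginals scaled by [P (cyl J B)] agree on rectangles. *)
Let partial_sum_cyl k (A : set R) (J : {fset nat}) (B : nat -> set R) :
  measurable A -> (forall i, i \in J -> (k <= i)%N) ->
  (forall i, i \in J -> measurable (B i)) ->
  P (S k @^-1` A `&` cyl J B) = (P (S k @^-1` A) * P (cyl J B))%E.
Proof.
(* The cylinder over later indices strengthens the induction: the step has to separate [S k] from
   [Ws k] and from the later variables simultaneously. *)
elim: k A J B => [|k IH] A J B mA Jk mB.
  have [A0|A0] := pselect (A 0).
    have -> : S 0%N @^-1` A = setT.
      by apply/seteqP; split => // w _; rewrite /= big_ord0.
    by rewrite setTI probability_setT mul1e.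
  have -> : S 0%N @^-1` A = set0.
    by apply/seteqP; split => // w /=; rewrite big_ord0.
  by rewrite set0I measure0 mul0e.
have mE := measurable_cyl mB; set E := cyl J B in mE *.
have mZ : measurable_fun setT (fun w => (S k w, Ws k w)) by exact: measurable_fun_pair.
pose Z : {RV P >-> (R * R)%type} := mfun_Sub (mem_set mZ).
have PE0 : 0 <= fine (P E) by rewrite fine_ge0.
pose r := NngNum PE0.
have rE : (r%:num)%:E = P E by rewrite /= fineK// fin_num_measure.
have rect C D : measurable C -> measurable D ->
    P (S k @^-1` C `&` (Ws k @^-1` D `&` E)) =
    (P (S k @^-1` C) * (P (Ws k @^-1` D) * P E))%E.
  move=> mC mD.
  (* The condition on [Ws k] is absorbed into the cylinder, so that the induction hypothesis splits
     off [S k] alone. *)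
  pose B' i := if i == k then D else B i.
  have kJ : k \notin J by apply/negP => /Jk; rewrite ltnn.
  have EB : Ws k @^-1` D `&` E = cyl (k |` J)%fset B'.
    rewrite /cyl bigcap_fsetU1 {1}/B' eqxx; congr (_ `&` _).
    by apply: eq_bigcapr => i /= iJ; rewrite /B'; case: eqP iJ kJ => // -> ->.
  have mB' i : i \in (k |` J)%fset -> measurable (B' i).
    by rewrite /B' in_fset1U; case: eqP => //= _ /mB.
  rewrite EB IH//; last first.
    by move=> i; rewrite in_fset1U => /predU1P[->//|/Jk/ltnW].
  rewrite [P (cyl _ _)]indep// big_fsetU1//= {1}/B' eqxx /E /cyl [P (\bigcap_(_ in _)
      _)]indep//.
  congr (_ * (_ * _))%E; rewrite big_seq [RHS]big_seq; apply: eq_bigr => i iJ.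
  by rewrite /B'; case: eqP iJ kJ => // -> ->.
have e1 X : measurable X ->
    (mscale r (distribution P (S k)) \x distribution P (Ws k))%E X = P (Z @^-1` X `&` E).
  move=> mX; rewrite (product_measure_unique (m' := pushforward (mrestr P mE) Z))//.
  move=> C D mC mD; rewrite /pushforward/= /mrestr.
  have ZE : Z @^-1` (C `*` D) `&` E = S k @^-1` C `&` (Ws k @^-1` D `&` E).
    by apply/seteqP; split => w [] => [[]|? []].
  rewrite -[LHS]/(P (Z @^-1` (C `*` D) `&` E)) ZE rect// /mscale /= rE.
  by rewrite muleA muleC muleA.
have e2 X : measurable X ->
    (mscale r (distribution P (S k)) \x distribution P (Ws k))%E X =
        (P E * P (Z @^-1` X))%E.
  move=> mX; rewrite (product_measure_unique (m' := mscale r (distribution P Z)))//.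
    by rewrite -[LHS]/((r%:num)%:E * _)%E rE.
  move=> C D mC mD; rewrite -[RHS]/((r%:num)%:E * _ * _)%E -[LHS]/((r%:num)%:E * _)%E
      rE -muleA; congr (_ * _)%E.
  rewrite -[LHS]/(P (Z @^-1` (C `*` D))).
  have -> : Z @^-1` (C `*` D) = S k @^-1` C `&` cyl [fset k]%fset (fun=> D).
    by rewrite /cyl set_fset1 bigcap_set1.
  rewrite IH ?/cyl ?set_fset1 ?bigcap_set1//.
  by move=> i; rewrite in_fset1 => /eqP ->.
have mC : measurable ((@pair_add R) @^-1` A) by rewrite -[X in measurable X]setTI;
    exact: measurable_pair_add.
have SE : S k.+1 @^-1` A = Z @^-1` ((@pair_add R) @^-1` A).
  by apply/seteqP; split => w /=; rewrite /pair_add /= big_ord_recr.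
by rewrite SE -e1// e2// muleC.
Qed.

Lemma independent2_partial_sum n : independent2 P (S n) (Ws n).
Proof.
move=> A B mA mB.
have := @partial_sum_cyl n A [fset n]%fset (fun=> B) mA.
rewrite /cyl set_fset1 bigcap_set1; apply => //.
by move=> i; rewrite in_fset1 => /eqP ->.
Qed.

Lemma independent2_pair i j : i != j -> independent2 P (Ws i) (Ws j).
Proof.
move=> ij A B mA mB.
pose C k := if k == i then A else B.
have := indep (J := [fset i; j]%fset) (B := C).
rewrite set_fsetU !set_fset1 bigcap_setU !bigcap_set1 big_fsetU1 ?in_fset1//=.
rewrite big_seq_fset1 /C eqxx eq_sym (negPf ij); apply.
by move=> k _; case: ifP.
Qed.

Lemma sqchf_partial_sum (W : {RV P >-> R}) n (t : R) :
  (forall i, identically_distributed (Ws i) W) ->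
  sqchf P (fun w => \sum_(i < n) Ws i w) t = sqchf P W t ^+ n.
Proof.
move=> WW; elim: n => [|n IH].
  rewrite expr0 -(sqchf0 P (measurable_partial_sum 0)) /sqchf.
  by congr (_ ^+ 2 + _ ^+ 2); apply: eq_Rintegral => w _; rewrite big_ord0 mulr0 mul0r.
rewrite exprSr -IH -(sqchf_distribution W) -(eq_sqchf t (WW n)).
rewrite sqchf_distribution -(sqchf_independentD t (independent2_partial_sum n)).
by rewrite /sqchf; congr (_ ^+ 2 + _ ^+ 2); apply: eq_Rintegral => w _ /=;
    rewrite big_ord_recr.
Qed.

End partial_sums.

(** * Moments *)

Lemma nneseries_geometric_le (R : realType) (u : nat -> R) (c q : R) :
  0 <= c -> 0 < q < 1 -> (forall n, 0 <= u n <= c * q ^+ n) ->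
  (\sum_(0 <= n <oo) (u n)%:E <= (c / (1 - q))%:E)%E.
Proof.
move=> c0 /andP[q0 q1] Hu.
apply: lime_le.
  by apply: is_cvg_nneseries => n _ _; rewrite lee_fin; case/andP: (Hu n).
apply: nearW => n; rewrite sumEFin lee_fin.
apply: (@le_trans _ _ (series (geometric c q) n)); last first.
  by apply: geometric_le_lim => //; rewrite ger0_norm// ltW.
rewrite /series /=; apply: ler_sum => i _; by case/andP: (Hu i).
Qed.

Section moments.
Context d (T : measurableType d) (R : realType) (P : probability T R).
Context (W : {RV P >-> R}) (W0 : forall w, 0 <= W w).

Let measurable_le (x : R) : measurable [set w | W w <= x].
Proof.
rewrite -[X in measurable X]setTI; apply: measurable_fun_le => //; exact: measurable_cst.
Qed.

Lemma probability_le_half :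
  exists2 M : R, 0 <= M & ((2^-1)%:E <= P [set w | (W w <= M)%R])%E.
Proof.
have [M HM] : exists M, ((2^-1)%:E <= cdf W M)%E.
  apply: contrapT => /forallNP h.
  have : (1 <= (2^-1)%:E :> \bar R)%E.
    apply: cvge_le (cvg_cdfy1 W); apply: nearW => x.
    by rewrite ltW// ltNge; apply/negP; exact: h.
  by rewrite lee_fin leNgt invf_lt1// ltr1n.
exists (Num.max M 0); first by rewrite le_max lexx orbT.
apply: (le_trans HM); rewrite /cdf /distribution /pushforward.
have mM : measurable (W @^-1` `]-oo, M]) by apply: measurable_funPTI.
apply: le_measure; [exact: mem_set|exact: mem_set|].
by move=> w; rewrite /= in_itv/= le_max => ->.
Qed.

(* If [W z.1] is large and [W z.2 <= M] then the difference is large. *)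
Lemma tail_le_trunc_sqr (M x : R) : ((2^-1)%:E <= P [set w | (W w <= M)%R])%E -> 0 < x ->
  (P [set w | (x + M <= W w)%R] <= (2 * trunc_sqr P W x^-1)%:E)%E.
Proof.
move=> HM x0.
pose A := [set w | x + M <= W w]; pose B := [set w | W w <= M].
have mA : measurable A by exact: measurable_set_ge.
have mB : measurable B by exact: measurable_le.
have mAB : measurable (A `*` B) by exact: measurableX.
have b := bdd_indic R mAB.
have : \int[(P \x P)%E]_z \1_(A `*` B) z <= trunc_sqr P W x^-1.
  apply: le_bdd_Rintegral => //; first exact: bdd_trunc_sqr.
  move=> [u v]; rewrite indicE; case: (boolP ((u, v) \in A `*` B)) => [|_]; last first.
    by rewrite le_min ler01 sqr_ge0.
  move=> /set_mem[/= Au Bv]; rewrite le_min lexx/= -{1}(expr1n R 2).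
  have uv : x <= W u - W v by rewrite lerBrDr; apply: le_trans Au; rewrite lerD2l.
  rewrite lerXn2r ?nnegrE ?mulr_ge0 ?invr_ge0 ?(ltW x0) ?(le_trans (ltW x0) uv)//.
  by rewrite mulrC ler_pdivlMr// mul1r.
rewrite /Rintegral integral_indic//= setIT product_measure1E// fineM
    ?fin_num_measure// => h.
have PA : P A = (fine (P A))%:E by rewrite fineK// fin_num_measure.
have PB : P B = (fine (P B))%:E by rewrite fineK// fin_num_measure.
rewrite -/A PA lee_fin.
have : 2^-1 <= fine (P B) by rewrite -lee_fin -PB.
have pA0 : 0 <= fine (P A) by rewrite fine_ge0.
move=> /(ler_wpM2l pA0) h'; have := le_trans h' h; lra.
Qed.

(** Dyadic layers shifted by [M]: the layer [j] has weight of order [2 ^ (j g)] and, by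
    [tail_le_trunc_sqr] at [x = 2 ^+ j], probability at most [2 K 2 ^ (- j b)], so the layers sum
    like a geometric series of ratio [2 ^ (g - b) < 1]. *)
Lemma moment_lty (K b g : R) : 0 <= K -> 0 < g < b ->
  (forall u : R, 0 < u <= 1 -> trunc_sqr P W u <= K * u `^ b) ->
  (\int[P]_w (W w `^ g)%:E < +oo)%E.
Proof.
move=> K0 /andP[g0 gb] HK.
have [M M0 HM] := probability_le_half.
have b0 : 0 < b by exact: lt_trans gb.
pose A j := [set w | 2 ^+ j + M <= W w].
have mA j : measurable (A j) by exact: measurable_set_ge.
(* [2 ^+ j.+1 + M] is at most [(1 + M) * 2 ^+ j.+1], so [c] pays for the shift by [M] as well as for
   the values below [1 + M]. *)
pose c := (1 + M) `^ g.
have c0 : 0 <= c by exact: powR_ge0.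
pose f j w : \bar R := ((2 ^+ j.+1) `^ g * \1_(A j) w)%:E.
have f0 j w : (0 <= f j w)%E by rewrite lee_fin mulr_ge0 ?powR_ge0.
have mf j : measurable_fun setT (f j).
  by apply/measurable_EFinP/measurable_funM => //; exact: measurable_indic.
have bound w : ((W w `^ g)%:E <= c%:E * (1 + \sum_(0 <= j <oo) f j w))%E.
  have s0 : (0 <= \sum_(0 <= j <oo) f j w)%E by apply: nneseries_ge0 => j _ _; exact: f0.
  have [w1|w1] := ltP (W w) (1 + M).
    apply: (@le_trans _ _ (c%:E * 1)%E); last by rewrite lee_wpmul2l ?lee_fin// leeDl.
    rewrite mule1 lee_fin ge0_ler_powR ?nnegrE ?(ltW g0) ?W0 ?addr_ge0//; exact: ltW.
  have v1 : 0 < (W w - M)^-1 <= 1.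
    by rewrite invr_gt0 invf_le1 ?subr_gt0; [apply/andP; split; lra|lra].
  have [j /andP[j1 j2]] : exists j, 2 ^+ j <= W w - M < 2 ^+ j.+1.
    have h12 : 0 < (2 : R)^-1 < 1 by rewrite invr_gt0 ltr0n invf_lt1// ltr1n.
    have [j /andP[j1 j2]] := geometric_between h12 v1.
    have wm : 0 < W w - M by lra.
    rewrite exprVn ltf_pV2 ?posrE ?exprn_gt0// in j1.
    rewrite exprVn lef_pV2 ?posrE ?exprn_gt0// in j2.
    by exists j; rewrite j1 j2.
  apply: (@le_trans _ _ (c%:E * f j w)%E).
    rewrite /f indicE mem_set/=; last by rewrite /A/= -lerBrDr.
    rewrite mulr1 -EFinM lee_fin -powRM ?exprn_ge0 ?addr_ge0//.
    rewrite ge0_ler_powR ?nnegrE ?(ltW g0) ?W0 ?mulr_ge0 ?exprn_ge0 ?addr_ge0//.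
    have : 1 <= 2 ^+ j.+1 :> R by rewrite exprn_ege1// ler1n.
    move=> /(ler_wpM2l M0); lra.
  rewrite lee_wpmul2l ?lee_fin//.
  apply: (@le_trans _ _ (\sum_(0 <= j <oo) f j w)%E); last by rewrite leeDr.
  apply: le_trans (nneseries_lim_ge j.+1 _); last by move=> *; exact: f0.
  by rewrite big_nat_recr//= leeDr// sume_ge0.
have mS : measurable_fun setT (fun w => \sum_(0 <= j <oo) f j w)%E.
  by apply: ge0_emeasurable_sum => // j w _ _; exact: f0.
apply: (@le_lt_trans _ _ (\int[P]_w (c%:E * (1 + \sum_(0 <= j <oo) f j w)))%E).
  apply: ge0_le_integral => //.
  - by move=> w _; rewrite lee_fin powR_ge0.
  - by apply/measurable_EFinP; apply: (measurableT_comp (measurable_powR g)).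
  - by apply: emeasurable_funM => //; apply: emeasurable_funD.
rewrite ge0_integralZl//; last 2 first.
- by apply: emeasurable_funD.
- by move=> w _; rewrite adde_ge0// nneseries_ge0.
rewrite ge0_integralD//; last by move=> w _; apply: nneseries_ge0 => *; exact: f0.
rewrite integral_cst// [X in (1 * X)%E](probability_setT P) mule1.
rewrite integral_nneseries//.
have fE j : (\int[P]_w f j w = ((2 ^+ j.+1) `^ g * fine (P (A j)))%:E)%E.
  rewrite /f; under eq_integral do rewrite EFinM.
  rewrite ge0_integralZl//; last by apply/measurable_EFinP; exact: measurable_indic.
  by rewrite integral_indic// setIT EFinM fineK// fin_num_measure.
under eq_eseriesr do rewrite fE.
pose q : R := 2 `^ (g - b).
have q01 : 0 < q < 1.
  rewrite powR_gt0//=; have -> : q = (2 `^ (b - g))^-1 by rewrite -powRN opprB.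
  rewrite invf_lt1 ?powR_gt0//.
  have := @gt0_ltr_powR R (b - g); rewrite subr_gt0 => /(_ gb 1 2).
  by rewrite powR1 !nnegrE; apply; rewrite ?ltr1n.
have S : (\sum_(0 <= j <oo) ((2 ^+ j.+1) `^ g * fine (P (A j)))%:E <=
    (2 `^ g * (2 * K) / (1 - q))%:E)%E.
  apply: nneseries_geometric_le => //; first by rewrite !mulr_ge0// powR_ge0.
  move=> j; rewrite mulr_ge0 ?powR_ge0 ?fine_ge0//=.
  have h2 : 0 < 2 ^+ j :> R by rewrite exprn_gt0.
  have h3 : fine (P (A j)) <= 2 * K * (2 `^ (- b)) ^+ j.
    have := tail_le_trunc_sqr HM h2.
    rewrite -/(A j) -[P (A j)]fineK ?fin_num_measure// lee_fin.
    move=> /le_trans; apply; rewrite -mulrA ler_pM2l//.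
    have u1 : 0 < (2 ^+ j : R)^-1 <= 1.
      by rewrite invr_gt0 h2 invf_le1// exprn_ege1// ler1n.
    apply: (le_trans (HK _ u1)).
    rewrite -powR_invn// -powRrM -(powR_mulrn j) ?powR_ge0// -powRrM.
    by rewrite !mulNr [j%:R * b]mulrC.
  have -> : q ^+ j = (2 ^+ j) `^ g * (2 `^ (- b)) ^+ j.
    rewrite /q powRD; last by rewrite pnatr_eq0 implybT.
    rewrite exprMn -(powR_mulrn j (powR_ge0 2 g)) -(powR_mulrn j (ler0n R 2)).
    by rewrite powRAC.
  rewrite exprS powRM ?exprn_ge0//.
  have h4 : 0 <= 2 `^ g * (2 ^+ j) `^ g by rewrite mulr_ge0 ?powR_ge0.
  apply: (le_trans (ler_wpM2l h4 h3)).
  by rewrite le_eqVlt; apply/orP; left; apply/eqP; ring.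
apply: (@le_lt_trans _ _ (c%:E * (1 + (2 `^ g * (2 * K) / (1 - q))%:E))%E).
  by rewrite lee_wpmul2l ?lee_fin// leeD2l.
by rewrite -EFinD -EFinM ltry.
Qed.

End moments.

(** * Edges of the random graph *)

(* [X] is the uniform limit of the step functions [floor(N X) / N], which are
   combinations of indicators of events [X >= k / N]. *)
Lemma Rintegral_mul_eq0 d (T : measurableType d) (R : realType)
    (P : probability T R) (X Y : T -> R) :
  measurable_fun setT X -> (forall w, 0 <= X w <= 1) ->
  measurable_fun setT Y -> (forall w, `|Y w| <= 1) ->
  (forall C : set R, measurable C -> \int[P]_w (Y w * \1_(X @^-1` C) w) = 0) ->
  \int[P]_w (Y w * X w) = 0.
Proof.
move=> mX X01 mY Y1 H.
have bX : bdd_measurable X.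
  by split => //; exists 1 => w; have /andP[? ?] := X01 w; rewrite ger0_norm.
have bY : bdd_measurable Y by split => //; exists 1.
have mXC C : measurable C -> measurable (X @^-1` C).
  by move=> mC; rewrite -[X in measurable X]setTI; exact: mX.
suff le N : `|\int[P]_w (Y w * X w)| <= N.+1%:R^-1.
  apply/eqP; rewrite -normr_eq0 -[_ == 0]negbK; apply/negP => h.
  have {}h : 0 < `|\int[P]_w (Y w * X w)| by rewrite lt0r h normr_ge0.
  have := le (Num.truncn (`|\int[P]_w (Y w * X w)|^-1)).
  rewrite leNgt => /negP; apply.
  by rewrite invf_plt ?posrE ?ltr0n//; exact: truncnS_gt.
pose A k := X @^-1` `[k.+1%:R / N.+1%:R, +oo[.
have mA k : measurable (A k) by apply: mXC; exact: measurable_itv.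
pose s w : R := \sum_(k < N.+1) \1_(A k) w.
have bs n : bdd_measurable (fun w => \sum_(k < n) \1_(A k) w : R).
  elim: n => [|n IH].
    rewrite (_ : (fun w => _) = (fun=> 0)); first exact: bdd_cst.
    by apply/funext => w; rewrite big_ord0.
  rewrite (_ : (fun w => _) = (fun w => (\sum_(k < n) \1_(A k) w : R) + \1_(A n) w)).
    by apply: bddD => //; exact: bdd_indic.
  by apply/funext => w; rewrite big_ord_recr.
have s0 n : \int[P]_w (Y w * \sum_(k < n) \1_(A k) w) = 0.
  elim: n => [|n IH].
    rewrite (_ : (fun w => _) = (fun=> 0)); first exact: Rintegral_cst1.
    by apply/funext => w; rewrite big_ord0 mulr0.
  rewrite (_ : (fun w => _) = (fun w => Y w * \sum_(k < n) \1_(A k) w + Y w * \1_(A n) w)).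
    rewrite bdd_RintegralD ?IH ?add0r; [|exact: bddM|by apply: bddM => //;
        exact: bdd_indic].
    by apply: H; exact: measurable_itv.
  by apply/funext => w; rewrite big_ord_recr mulrDr.
have sE w : s w = (Num.truncn (X w * N.+1%:R))%:R.
  have /andP[x0 x1] := X01 w.
  have y0 : 0 <= X w * N.+1%:R by rewrite mulr_ge0.
  have tN : (Num.truncn (X w * N.+1%:R) <= N.+1)%N.
    by rewrite -(ler_nat R); apply: le_trans (_ : X w * N.+1%:R <= _);
        rewrite ?truncn_le// ler_piMl.
  rewrite /s (eq_bigr (fun k : 'I_N.+1 => ((k < Num.truncn (X w * N.+1%:R))%N)%:R));
      last first.
    move=> k _; rewrite indicE truncn_ge_nat//; congr (_%:R : R); congr nat_of_bool.
    rewrite -ler_pdivrMr//; apply/idP/idP.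
      by move/set_mem; rewrite /A /= in_itv/= andbT.
    by move=> h; apply: mem_set; rewrite /A /= in_itv/= andbT.
  rewrite -natr_sum; congr (_%:R).
  have -> n m : (\sum_(k < n) (k < m)%N = minn n m)%N.
    elim: n => [|n IH]; first by rewrite big_ord0 min0n.
    rewrite big_ord_recr /= IH; case: (ltnP n m) => nm.
      by rewrite (minn_idPl nm) addn1.
    by rewrite addn0 (minn_idPr _)// leqW.
  exact/minn_idPr.
have E : \int[P]_w (Y w * X w) = \int[P]_w (Y w * (X w - N.+1%:R^-1 * s w)).
  have bsN : bdd_measurable (fun w => N.+1%:R^-1 * s w) by apply: bddM;
      [exact: bdd_cst|exact: bs].
  transitivity (\int[P]_w (Y w * X w) - N.+1%:R^-1 * \int[P]_w (Y w * s w)).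
    by rewrite s0 mulr0 subr0.
  rewrite -bdd_RintegralZ; last by apply: bddM => //; exact: bs.
  rewrite -bdd_RintegralB; [|exact: bddM|].
    by apply: eq_Rintegral => w _; rewrite mulrBr mulrCA.
  by apply: bddM; [exact: bdd_cst|apply: bddM => //; exact: bs].
have bXs : bdd_measurable (fun w => X w - N.+1%:R^-1 * s w).
  by apply: bddB => //; apply: bddM; [exact: bdd_cst|exact: bs].
have bYXs := bddM bY bXs.
rewrite E; apply: le_trans (norm_Rintegral_le P bYXs) _.
rewrite -[leRHS](Rintegral_cst1 P); apply: le_bdd_Rintegral.
- exact: bdd_norm.
- exact: bdd_cst.
move=> w; rewrite normrM -[leRHS]mul1r ler_pM//.
have /andP[x0 x1] := X01 w.
have y0 : 0 <= X w * N.+1%:R by rewrite mulr_ge0.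
have /andP[t1 t2] := truncn_itv y0; rewrite sE.
have N0 : 0 < N.+1%:R :> R by [].
have -> : X w - N.+1%:R^-1 * (Num.truncn (X w * N.+1%:R))%:R =
    (X w * N.+1%:R - (Num.truncn (X w * N.+1%:R))%:R) / N.+1%:R.
  by rewrite mulrBl mulfK ?gt_eqF// [in RHS]mulrC.
rewrite ger0_norm ?divr_ge0 ?subr_ge0//.
by rewrite ler_pdivrMr// mulVf ?gt_eqF// lerBlDr addrC natr1 ltW.
Qed.

Section random_graph.
Context d (T : measurableType d) (R : realType) (P : probability T R) (n : nat).
Context (W : 'I_n -> {RV P >-> R}) (W0 : forall i w, 0 <= W i w).
Context (G : T -> rel 'I_n) (HG : generalized_random_graph W G).

Let x w := fun i => W i w.
Definition edge (e : 'I_n * 'I_n) (w : T) : R := (G w e.1 e.2)%:R.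
Definition edge_prob (e : 'I_n * 'I_n) (w : T) : R := grg_prob (x w) e.1 e.2.

Lemma grg_prob_itv (y : 'I_n -> R) i j : (forall k, 0 <= y k) ->
  0 <= grg_prob y i j <= 1.
Proof.
move=> y0; rewrite /grg_prob; case: eqP => [_|/eqP L0]; first by rewrite lexx ler01.
have L1 : 0 < \sum_(k < n) y k by rewrite lt0r L0 sumr_ge0.
have yy : 0 <= y i * y j by rewrite mulr_ge0.
have D0 : 0 < \sum_(k < n) y k + y i * y j by lra.
by rewrite divr_ge0 ?(ltW D0)//= ler_pdivrMr// mul1r lerDr ltW.
Qed.

Let sigma_sub (A : set T) : g_sigma_preimage (fun i => W i : T -> R) A -> measurable A.
Proof.
rewrite /g_sigma_preimage.
move: A; apply: smallest_sub; first exact: sigma_algebra_measurable.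
elim/big_ind: _ => //.
- by move=> A B AB BB X [/AB|/BB].
- by move=> i _ X [Y mY <-]; rewrite setTI; apply: measurable_funPTI.
Qed.

Let cond (S : {set 'I_n * 'I_n}) (SE : forall e, e \in S -> (e.1 < e.2)%N) :
  is_cond_probability P (g_sigma_preimage (fun i => W i : T -> R))
    [set w | forall e, e \in S -> G w e.1 e.2]
    (fun w => \prod_(e in S) grg_prob (fun i => W i w) e.1 e.2).
Proof. by have [_ _] := HG; exact. Qed.

(** The measurability clause of [is_cond_probability] for the singleton [[set e]]. *)
Lemma sigma_edge_prob (e : 'I_n * 'I_n) C : (e.1 < e.2)%N -> measurable C ->
  g_sigma_preimage (fun i => W i : T -> R) (edge_prob e @^-1` C).
Proof.
move=> e12 mC.
have [|+ _] := @cond [set e]%SET; first by move=> f; rewrite inE => /eqP ->.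
move=> /(_ _ mC); congr (_ _); apply/seteqP; split => w /=; by rewrite big_set1.
Qed.

Lemma measurable_edge_prob (e : 'I_n * 'I_n) : (e.1 < e.2)%N -> measurable_fun setT
    (edge_prob e).
Proof. by move=> e12 _ C mC; rewrite setTI; apply: sigma_sub; exact: sigma_edge_prob. Qed.

Lemma edge_prob_itv (e : 'I_n * 'I_n) w : 0 <= edge_prob e w <= 1.
Proof. by apply: grg_prob_itv => k; exact: W0. Qed.

Lemma bdd_edge_prob (e : 'I_n * 'I_n) : (e.1 < e.2)%N -> bdd_measurable (edge_prob e).
Proof.
move=> e12; split; first exact: measurable_edge_prob.
by exists 1 => w; have /andP[? ?] := edge_prob_itv e w; rewrite ger0_norm.
Qed.

Let measurable_edge (e : 'I_n * 'I_n) : measurable [set w | G w e.1 e.2].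
Proof. by have [_ + _] := HG; exact. Qed.

Lemma edgeE (e : 'I_n * 'I_n) : edge e = \1_[set w | G w e.1 e.2].
Proof.
apply/funext => w; rewrite /edge indicE; congr (nat_of_bool _)%:R.
by apply/idP/idP => [h|/set_mem//]; exact: mem_set.
Qed.

Lemma bdd_edge (e : 'I_n * 'I_n) : bdd_measurable (edge e).
Proof. by rewrite edgeE; exact: bdd_indic. Qed.

Lemma edge_cond (e : 'I_n * 'I_n) B : (e.1 < e.2)%N ->
  g_sigma_preimage (fun i => W i : T -> R) B ->
  \int[P]_w (edge e w * \1_B w) = \int[P]_w (edge_prob e w * \1_B w).
Proof.
move=> e12 GB; have mB := sigma_sub GB.
have [|_ /(_ B GB) h] := @cond [set e]%SET; first by move=> f; rewrite inE => /eqP ->.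
rewrite [RHS]Rintegral_indicM.
transitivity (\int[P]_w (\1_([set w | G w e.1 e.2] `&` B) w : R)).
  by apply: eq_Rintegral => w _; rewrite edgeE indicI.
rewrite Rintegral_indic; last exact: measurableI.
rewrite /Rintegral; congr fine.
transitivity (P ([set w | forall f, f \in [set e]%SET -> G w f.1 f.2] `&` B)).
  congr (P (_ `&` _)); apply/seteqP; split => w /= Gw; last by apply: Gw; rewrite inE.
  by move=> f; rewrite inE => /eqP ->.
by rewrite h; apply: eq_integral => w _; rewrite big_set1.
Qed.

(** The conditional identity speaks of events generated by the weights; [Rintegral_mul_eq0] extends
    it to the factor [edge_prob f], which is measurable with respect to them. *)
Lemma edge_prob_ortho (e f : 'I_n * 'I_n) : (e.1 < e.2)%N -> (f.1 < f.2)%N ->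
  \int[P]_w ((edge e w - edge_prob e w) * edge_prob f w) = 0.
Proof.
move=> e12 f12.
have be := bdd_edge e; have bp := bdd_edge_prob e12.
apply: Rintegral_mul_eq0.
- exact: measurable_edge_prob.
- by move=> w; exact: edge_prob_itv.
- by have [] := bddB be bp.
- move=> w; have /andP[p0 p1] := edge_prob_itv e w; rewrite /edge.
  by rewrite ler_norml; case: (G w _ _) => /=; apply/andP; split; lra.
move=> C mC; have GC := sigma_edge_prob f12 mC.
have bi := bdd_indic R (sigma_sub GC).
under eq_Rintegral do rewrite mulrBl.
by rewrite bdd_RintegralB; [rewrite edge_cond// subrr|exact: bddM|exact: bddM].
Qed.

(** The graph hypothesis for the set of the two edges, tested on the whole space. *)
Lemma edge_mul (e f : 'I_n * 'I_n) : (e.1 < e.2)%N -> (f.1 < f.2)%N -> e != f ->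
  \int[P]_w (edge e w * edge f w) = \int[P]_w (edge_prob e w * edge_prob f w).
Proof.
move=> e12 f12 ef.
have [|GT h] := @cond [set e; f]%SET; first by move=> g; rewrite !inE => /orP[] /eqP ->.
have {}GT : g_sigma_preimage (fun i => W i : T -> R) setT.
  by have := GT setT measurableT; rewrite preimage_setT.
have {h} := h _ GT; rewrite setIT => h.
transitivity (\int[P]_w (\1_([set w | G w e.1 e.2] `&` [set w | G w f.1 f.2]) w : R)).
  by apply: eq_Rintegral => w _; rewrite !edgeE indicI.
rewrite Rintegral_indic; last exact: measurableI.
rewrite /Rintegral; congr fine.
transitivity (P [set w | forall g, g \in [set e; f]%SET -> G w g.1 g.2]).
  congr (P _); apply/seteqP; split => w /=.
    by move=> [Ge Gf] g; rewrite !inE => /orP[] /eqP ->.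
  by move=> Gw; split; apply: Gw; rewrite !inE eqxx ?orbT.
rewrite h; apply: eq_integral => w _.
by rewrite big_setU1 ?big_set1 ?inE.
Qed.

Let dev (e : 'I_n * 'I_n) w := edge e w - edge_prob e w.

Let bdd_dev (e : 'I_n * 'I_n) : (e.1 < e.2)%N -> bdd_measurable (dev e).
Proof. by move=> e12; apply: bddB; [exact: bdd_edge|exact: bdd_edge_prob]. Qed.

(** By orthogonality [dev f] may be replaced by [edge f]. For distinct edges conditional
    independence then cancels everything; for [e = f] the product is at most [edge e], whose
    integral is that of [edge_prob e]. *)
Lemma dev_cov (e f : 'I_n * 'I_n) : (e.1 < e.2)%N -> (f.1 < f.2)%N ->
  \int[P]_w (dev e w * dev f w) <=
  if e == f then \int[P]_w edge_prob e w else 0.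
Proof.
move=> e12 f12.
have be := bdd_edge e; have bf := bdd_edge f.
have bpe := bdd_edge_prob e12; have bpf := bdd_edge_prob f12.
have E : \int[P]_w (dev e w * dev f w) = \int[P]_w (dev e w * edge f w).
  rewrite -[RHS]subr0 -(edge_prob_ortho e12 f12) -bdd_RintegralB.
  - by apply: eq_Rintegral => w _; rewrite -mulrBr.
  - by apply: bddM => //; exact: bdd_dev.
  - by apply: bddM => //; exact: bdd_dev.
case: eqP => [ef|/eqP ef]; last first.
  rewrite E; under eq_Rintegral do rewrite mulrBl.
  rewrite bdd_RintegralB ?edge_mul//; [|exact: bddM|exact: bddM].
  have h : \int[P]_w ((edge f w - edge_prob f w) * edge_prob e w) =
      \int[P]_w (edge_prob e w * edge f w) - \int[P]_w (edge_prob e w * edge_prob f w).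
    rewrite -bdd_RintegralB; [|exact: bddM|exact: bddM].
    by apply: eq_Rintegral => w _; ring.
  by have := edge_prob_ortho f12 e12; lra.
subst f.
have -> : \int[P]_w edge_prob e w = \int[P]_w edge e w.
  have GT : g_sigma_preimage (fun i => W i : T -> R) setT.
    by have := sigma_edge_prob e12 measurableT; rewrite preimage_setT.
  have h (g : T -> R) : \int[P]_w (g w * \1_setT w) = \int[P]_w g w.
    by apply: eq_Rintegral => w _; rewrite indicT mulr1.
  by rewrite -[LHS]h -[RHS]h edge_cond.
rewrite E; apply: le_bdd_Rintegral => //; first by apply: bddM => //; exact: bdd_dev.
move=> w; rewrite /dev; have /andP[p0 p1] := edge_prob_itv e w.
by rewrite /edge; case: (G w _ _) => /=; lra.
Qed.

Let pairs := [pred e : 'I_n * 'I_n | (e.1 < e.2)%N].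

Lemma edges_second_moment :
  \int[P]_w (\sum_(e | pairs e) (edge e w - edge_prob e w)) ^+ 2 <=
  \sum_(e | pairs e) \int[P]_w edge_prob e w.
Proof.
have -> : \int[P]_w (\sum_(e | pairs e) (edge e w - edge_prob e w)) ^+ 2 =
    \sum_(e | pairs e) \sum_(f | pairs f) \int[P]_w (dev e w * dev f w).
  under [RHS]eq_bigr => e e12.
    rewrite -bdd_Rintegral_sum; last by move=> f f12; apply: bddM; exact: bdd_dev.
    over.
  rewrite -bdd_Rintegral_sum.
    by apply: eq_Rintegral => w _; rewrite expr2 mulr_suml; apply: eq_bigr => e _;
        rewrite mulr_sumr.
  by move=> e e12; apply: bdd_sum => f f12; apply: bddM; exact: bdd_dev.
apply: ler_sum => e e12.
apply: (@le_trans _ _ (\sum_(f | pairs f) if e == f then \int[P]_w edge_prob e w else 0)).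
  by apply: ler_sum => f f12; exact: dev_cov.
rewrite (bigD1 e)//= eqxx big1 ?addr0// => f /andP[_ fe].
by rewrite eq_sym (negPf fe).
Qed.

Lemma num_edgesE w : (num_edges (G w))%:R = \sum_(e | pairs e) edge e w.
Proof.
rewrite /num_edges pair_big_dep /= natr_sum.
by apply: eq_bigl => -[i j].
Qed.

End random_graph.

(** * Bounds in probability *)

Lemma sqr_le_powR (R : realType) (y g : R) : 0 <= y <= 1 -> 1 <= g <= 2 ->
  y ^+ 2 <= y `^ g.
Proof.
move=> /andP[y0 y1] /andP[g1 g2].
have [->|yn0] := eqVneq y 0; first by rewrite expr0n powR_ge0.
have yp : 0 < y <= 1 by rewrite lt0r yn0 y0.
rewrite -(@powR_mulrn _ y 2)//.
exact: (ger_powR yp).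
Qed.

(** The difference is [q ^+ 2 / (1 + q)], at most both [q] and [q ^+ 2]. Interpolating to the power
    [g] matters because only moments of order below [alpha < 2] are at hand. *)
Lemma subr_div1D_le_powR (R : realType) (q g : R) : 0 <= q -> 1 <= g <= 2 ->
  0 <= q - q / (1 + q) <= q `^ g.
Proof.
move=> q0 g12; have q1 : 0 < 1 + q by rewrite ltr_wpDr.
have -> : q - q / (1 + q) = q ^+ 2 / (1 + q) by field; rewrite gt_eqF.
rewrite divr_ge0 ?sqr_ge0 ?(ltW q1)//=.
have [qle|qge] := leP q 1.
  have q01 : 0 <= q <= 1 by rewrite q0.
  apply: le_trans (sqr_le_powR q01 g12); rewrite ler_pdivrMr// ler_peMr ?sqr_ge0//; lra.
apply: (@le_trans _ _ q); last by rewrite le1r_powR ?(ltW qge)//; case/andP: g12.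
rewrite ler_pdivrMr// expr2 ler_wpM2l//; lra.
Qed.

(* [x_i x_j / L] sums to [L] over all [(i, j)]; the deficit consists of the
   diagonal and of the differences [q - q / (1 + q)] with [q = x_i x_j / L]. *)
Lemma grg_deficit (R : realType) n (x : 'I_n -> R) (g : R) :
  let L := \sum_(k < n) x k in
  (forall i, 0 <= x i) -> 0 < L -> 1 <= g <= 2 ->
  0 <= L - 2 * \sum_(e : 'I_n * 'I_n | (e.1 < e.2)%N) grg_prob x e.1 e.2 <=
    L `^ (1 - g) * \sum_(i < n) x i `^ g +
    L `^ (- g) * \sum_(i < n) \sum_(j < n | j != i) (x i `^ g * x j `^ g).
Proof.
move=> L x0 L0 g12.
pose p i j := grg_prob x i j.
have pE i j : p i j = (x i * x j / L) / (1 + x i * x j / L).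
  rewrite /p /grg_prob -/L gt_eqF//.
  have h : 0 <= x i * x j by rewrite mulr_ge0.
  field; rewrite !gt_eqF//; first by rewrite ltr_wpDr.
have psym i j : p i j = p j i by rewrite !pE [x i * _]mulrC.
have e1 : \sum_(e : 'I_n * 'I_n | (e.1 < e.2)%N) grg_prob x e.1 e.2 =
    \sum_(i < n) \sum_(j < n | (i < j)%N) p i j by rewrite pair_big_dep.
have e2 : \sum_(i < n) \sum_(j < n | (j < i)%N) p i j =
    \sum_(i < n) \sum_(j < n | (i < j)%N) p i j.
  rewrite (exchange_big_dep predT)//=; apply: eq_bigr => i _.
  by apply: eq_bigr => j _; exact: psym.
have e3 : 2 * \sum_(e : 'I_n * 'I_n | (e.1 < e.2)%N) grg_prob x e.1 e.2 =
    \sum_(i < n) \sum_(j < n | j != i) p i j.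
  rewrite e1 mulr_natl mulr2n -{1}e2 -big_split /=; apply: eq_bigr => i _.
  rewrite [RHS](bigID (fun j : 'I_n => (j < i)%N))/=; congr (_ + _); apply: eq_bigl => j.
    by rewrite -val_eqE /=; case: ltngtP.
  by rewrite -val_eqE /=; case: ltngtP.
have e4 : L = \sum_(i < n) (x i ^+ 2 / L) + \sum_(i < n) \sum_(j < n | j != i) (x i *
    x j / L).
  rewrite -big_split/=.
  rewrite (eq_bigr (fun i => x i)) // => i _.
  rewrite expr2 -(bigD1 (P := predT) (F := fun j => x i * x j / L) i)//=.
  by rewrite -mulr_suml -mulr_sumr -/L mulfK// gt_eqF.
have q0 i j : 0 <= x i * x j / L by rewrite divr_ge0 ?mulr_ge0// ltW.
rewrite {1 2}e4 e3 -addrA -sumrB.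
under [X in _ + X]eq_bigr do rewrite -sumrB.
have LV y : 0 <= y -> (y / L) `^ g = L `^ (- g) * y `^ g.
  move=> y0; rewrite powRM ?invr_ge0 ?(ltW L0)// mulrC; congr (_ * _).
  by rewrite -powR_inv1 ?(ltW L0)// -powRrM mulN1r.
apply/andP; split.
  apply: addr_ge0; first by apply: sumr_ge0 => i _; rewrite divr_ge0 ?sqr_ge0// ltW.
  apply: sumr_ge0 => i _; apply: sumr_ge0 => j _; rewrite pE.
  by have /andP[] := subr_div1D_le_powR (q0 i j) g12.
rewrite !mulr_sumr; apply: lerD; apply: ler_sum => i _.
  (* A weight never exceeds the total, so on the diagonal the square may be lowered to the power
     [g]. *)
  have y01 : 0 <= x i / L <= 1.
    rewrite divr_ge0 ?(ltW L0)//= ler_pdivrMr// mul1r /L (bigD1 i)//= lerDl.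
    exact: sumr_ge0.
  have -> : x i ^+ 2 / L = L * (x i / L) ^+ 2 by field; rewrite gt_eqF.
  have -> : L `^ (1 - g) * x i `^ g = L * (x i / L) `^ g.
    by rewrite LV// mulrA powRD ?(gt_eqF L0) ?implybT// powRr1 ?(ltW L0).
  by rewrite ler_pM2l//; exact: sqr_le_powR.
rewrite mulr_sumr; apply: ler_sum => j _; rewrite pE -powRM// -LV ?mulr_ge0//.
by have /andP[] := subr_div1D_le_powR (q0 i j) g12.
Qed.

Lemma markov_ge0 d (T : measurableType d) (R : realType) (P : probability T R)
    (Z : T -> R) (c : R) : measurable_fun setT Z -> (forall w, 0 <= Z w) -> 0 < c ->
  (P [set w | (c <= Z w)%R] <= (c^-1)%:E * \int[P]_w (Z w)%:E)%E.
Proof.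
move=> mZ Z0 c0; set A := [set w | _].
have mA : measurable A by exact: measurable_set_ge.
have mZ' : measurable_fun setT (fun w => (Z w)%:E) by exact/measurable_EFinP.
have c1 : (0 <= c^-1%:E)%E by rewrite lee_fin invr_ge0 ltW.
rewrite -ge0_integralZl//; last by move=> w _; rewrite lee_fin.
rewrite -(setIT A) -integral_indic//; apply: ge0_le_integral => //.
- exact/measurable_EFinP/measurable_indic.
- by apply/measurable_EFinP; apply: measurable_funM.
move=> w _; rewrite -EFinM lee_fin indicE.
case: (boolP (w \in A)) => [/set_mem wA|_]; last by rewrite mulr_ge0 ?invr_ge0 ?(ltW c0).
by rewrite mulrC ler_pdivlMr// mul1r.
Qed.

Lemma near_le_powR (R : realType) (s A : R) : 0 < s ->
  \forall n \near \oo, A <= n%:R `^ s.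
Proof.
move=> s0; near=> n.
have h : `|A| `^ s^-1 <= n%:R by near: n; exact: nbhs_infty_ger.
apply: le_trans (ler_norm A) _.
rewrite [leLHS](_ : _ = (`|A| `^ s^-1) `^ s); last first.
  by rewrite -powRrM mulVf ?gt_eqF// powRr1.
by apply: ge0_ler_powR; rewrite ?nnegrE ?powR_ge0 ?(ltW s0).
Unshelve. all: by end_near. Qed.

(** * Growth of the norming sequence *)

Section norming.
Context {R : realType} (a : nat -> R) (a0 : forall n, (0 < n)%N -> 0 < a n).

(** Applied with [p = 1 / 2] to the edge fluctuations and with [p = 2 - g] to the deficit. *)
Lemma near_powR_le_norming (b k p eta : R) : 0 < b -> 0 < k -> p * b < 1 -> 0 < eta ->
  (\forall n \near \oo, k * n%:R <= a n `^ b) ->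
  \forall n \near \oo, n%:R `^ p <= eta * a n.
Proof.
move=> b0 k0 pb eta0 Ha.
have s0 : 0 < 1 - p * b by rewrite subr_gt0.
near=> n.
have n0 : (0 < n)%N by near: n; exact: nbhs_infty_gt.
have n0' : 0 < n%:R :> R by rewrite ltr0n.
have h1 : k * n%:R <= a n `^ b by near: n; exact: Ha.
have h2 : (eta `^ b * k)^-1 <= n%:R `^ (1 - p * b) by near: n; exact: near_le_powR.
rewrite leNgt; apply/negP => h.
have an0 := a0 n0.
have /(_ _ _) := @gt0_ltr_powR _ b b0 (eta * a n) (n%:R `^ p).
rewrite !nnegrE => /(_ _ _ h);
    rewrite ltNge => /(_ (ltW (mulr_gt0 eta0 an0)) (powR_ge0 _ _))/negP; apply.
rewrite powRM ?(ltW eta0) ?(ltW an0)// -powRrM.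
have eb : 0 < eta `^ b by rewrite powR_gt0.
apply: le_trans (ler_wpM2l (ltW eb) h1).
have -> : n%:R `^ (p * b) = n%:R / n%:R `^ (1 - p * b).
  rewrite [in LHS](_ : p * b = 1 - (1 - p * b)); last by ring.
  by rewrite powRB ?(gt_eqF n0') ?implybT// powRr1 ?(ltW n0').
rewrite ler_pdivrMr ?powR_gt0//.
have ek : 0 < eta `^ b * k by rewrite mulr_gt0.
have := ler_wpM2l (mulr_ge0 (ltW ek) (ltW n0')) h2.
by rewrite mulrAC divff ?gt_eqF// mul1r !mulrA.
Unshelve. all: by end_near. Qed.

(** This keeps the total weight above half its mean, since its fluctuations are of order [a n]. *)
Lemma near_norming_le (b K A : R) : 1 < b -> 0 < K -> 0 < A ->
  (\forall n \near \oo, a n `^ b <= K * n%:R) ->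
  \forall n \near \oo, A * a n <= n%:R.
Proof.
move=> b1 K0 A0 Ha; have b0 : 0 < b by exact: lt_trans b1.
have s0 : 0 < b - 1 by rewrite subr_gt0.
near=> n.
have n0 : (0 < n)%N by near: n; exact: nbhs_infty_gt.
have n0' : 0 < n%:R :> R by rewrite ltr0n.
have h1 : a n `^ b <= K * n%:R by near: n; exact: Ha.
have h2 : A `^ b * K <= n%:R `^ (b - 1) by near: n; exact: near_le_powR.
rewrite leNgt; apply/negP => h.
have an0 := a0 n0.
have /(_ _ _) := @gt0_ltr_powR _ b b0 n%:R (A * a n).
rewrite !nnegrE => /(_ _ _ h);
    rewrite ltNge => /(_ (ltW n0') (ltW (mulr_gt0 A0 an0)))/negP; apply.
rewrite powRM ?(ltW A0) ?(ltW an0)//.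
have Ab : 0 < A `^ b by rewrite powR_gt0.
apply: (le_trans (ler_wpM2l (ltW Ab) h1)).
have -> : n%:R `^ b = n%:R `^ (b - 1) * n%:R.
  by rewrite mulrC mulr_powRB1 ?(ltW n0').
by rewrite mulrA ler_pM2r.
Unshelve. all: by end_near. Qed.

End norming.

(** Only [x] is confined to the segment, because in [slutsky] tightness is known for [X n] alone.
    Hence a covering argument by neighbourhoods that may leave the segment. *)
Lemma unif_continuous_itv (R : realType) (f : R -> R) (K e : R) :
  continuous f -> 0 < e ->
  exists2 dl : R, 0 < dl & forall x y, `|x| <= K -> `|x - y| <= dl -> `|f x - f y| <= e.
Proof.
move=> cf e0; have e20 : 0 < e / 2 by rewrite divr_gt0.
have /compact_near_coveringP nc := @segment_compact R (- K) K.
pose Q (dl : R) (x : R) := forall y, `|x - y| <= dl -> `|f x - f y| <= e.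
have loc (x : R) : \forall x' \near x & dl \near (0 : R)^'+, Q dl x'.
  have /cvgrPdist_le/(_ _ e20) := cf x.
  rewrite -nbhs_ballE => -[r /= r0 Hr].
  have r20 : 0 < r / 2 by rewrite divr_gt0.
  exists (ball x (r / 2), [set dl | 0 < dl < r / 2]).
    split => /=; first exact: nbhsx_ballx.
    near=> dl; apply/andP; split; near: dl; first exact: nbhs_right_gt.
    exact: nbhs_right_lt.
  move=> [x' dl] [/= xx' /andP[dl0 dlr]] y x'y.
  have xx1 : `|x - x' : R| < r / 2 := xx'.
  have xr : `|x - x' : R| < r by lra.
  have yr : `|x - y| < r by have := ler_distD x' x y; lra.
  have h1 : `|f x - f x'| <= e / 2 by exact: Hr.
  have h2 : `|f x - f y| <= e / 2 by exact: Hr.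
  by have := ler_distD (f x) (f x') (f y); rewrite (distrC (f x') (f x)); lra.
have nQ : \forall dl \near 0^'+, `[- K, K]%classic `<=` Q dl.
  by apply: nc => x _; exact: loc.
near (0 : R)^'+ => dl; exists dl.
  by near: dl; exact: nbhs_right_gt.
move=> x y xK; have : Q dl x; last by apply.
suff : `[- K, K]%classic `<=` Q dl by apply; rewrite /= in_itv/= -ler_norml.
by near: dl; exact: nQ.
Unshelve. all: by end_near. Qed.

Lemma slutsky d (T : measurableType d) (R : realType) (P : probability T R)
    (X Y : nat -> T -> R) (F : probability R R) :
  (forall n, measurable_fun setT (X n)) -> (forall n, measurable_fun setT (Y n)) ->
  cvg_in_distribution P X F ->
  (forall dl e : R, 0 < dl -> 0 < e ->
    \forall n \near \oo, (P [set w | (dl < `|X n w - Y n w|)%R] <= e%:E)%E) ->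
  cvg_in_distribution P Y F.
Proof.
move=> mX mY XF XY f cf [M0 fM0].
pose M := Num.max M0 1.
have fM x : `|f x| <= M by rewrite le_max fM0.
have M1 : 1 <= M by rewrite le_max lexx orbT.
have bf : bdd_measurable f.
  by split; [exact: continuous_measurable_fun|exists M].
have bfX n : bdd_measurable (f \o X n) by exact: bdd_comp.
have bfY n : bdd_measurable (f \o Y n) by exact: bdd_comp.
have EY n : 'E_P[f \o Y n]%E = (\int[P]_w (f (Y n w)))%:E.
  rewrite unlock /Rintegral fineK//; apply: integrable_fin_num => //.
  exact: (bdd_integrable P (bfY n)).
have EF : (\int[F]_x (f x)%:E = (\int[F]_x f x)%:E)%E.
  rewrite /Rintegral fineK//; apply: integrable_fin_num => //.
  exact: bdd_integrable.
rewrite EF; under eq_cvg do rewrite EY.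
apply: cvg_EFin; first exact: nearW.
have bfex : exists M' : R, forall x, `|f x| <= M' by exists M.
have XFR := cvg_in_distribution_Rintegral XF cf bfex.
apply/cvgrPdist_le => e e0.
have e20 : 0 < e / 2 by rewrite divr_gt0.
(* So that [e' + 2 * (2 * M * e')] is [e / 2]: [e'] for the variation of [f] on the good event and
   [2 * M * e'] for each exceptional event, [X n] large (where [clip1 d1] is [1]) and [X n] far from
   [Y n]. *)
pose e' := e / 2 / (1 + 4 * M).
have M40 : 0 < 1 + 4 * M by lra.
have e'0 : 0 < e' by rewrite divr_gt0.
have [d1 d10 Hd1] := clip1_tight XF e'0.
have [dl dl0 Hdl] := unif_continuous_itv d1^-1 cf e'0.
near=> n.
have h1 : `|\int[F]_x f x - \int[P]_w f (X n w)| <= e / 2.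
  by near: n; move/cvgrPdist_le : XFR; apply.
have h2 : \int[P]_w clip1 d1 (X n w) <= e' by near: n; exact: Hd1.
have h3 : (P [set w | (dl < `|X n w - Y n w|)%R] <= e'%:E)%E by near: n; exact: XY.
set A := [set w | _] in h3.
have mA : measurable A.
  apply: measurable_set_gt.
  by apply: measurableT_comp => //; exact: measurable_funB.
have bA := bdd_indic R mA.
have bc := bdd_clip1 (ltW d10) (mX n).
have h4 : `|\int[P]_w f (X n w) - \int[P]_w f (Y n w)| <= e / 2.
  rewrite -bdd_RintegralB; [|exact: bfX|exact: bfY].
  have bB := bddB (bfX n) (bfY n).
  apply: le_trans (norm_Rintegral_le P bB) _.
  apply: (@le_trans _ _ (\int[P]_w (e' + (2 * M * clip1 d1 (X n w) + 2 * M * \1_A w)))).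
    apply: le_bdd_Rintegral; first exact: bdd_norm.
      apply: bddD; first exact: bdd_cst.
      by apply: bddD; apply: bddM => //; exact: bdd_cst.
    move=> w /=.
    have f2 : `|f (X n w) - f (Y n w)| <= 2 * M.
      by apply: le_trans (ler_normB _ _) _; have := fM (X n w); have := fM (Y n w); lra.
    have c0 : 0 <= clip1 d1 (X n w) by rewrite clip1_ge0// ltW.
    have M20 : 0 <= 2 * M by lra.
    have k0 := mulr_ge0 M20 c0.
    have i0 : 0 <= 2 * M * \1_A w by rewrite mulr_ge0.
    have [XK|XK] := leP `|X n w| d1^-1; last first.
      have c1 : clip1 d1 (X n w) = 1.
        by apply/min_idPl; rewrite mulrC -ler_pdivrMr// mul1r ltW.
      by move: k0; rewrite c1; lra.
    have [XYd|XYd] := leP `|X n w - Y n w| dl.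
      by have := Hdl _ _ XK XYd; lra.
    have i1 : \1_A w = 1 :> R by rewrite indicE mem_set.
    by rewrite i1; lra.
  rewrite !bdd_RintegralD ?Rintegral_cst1 ?bdd_RintegralZ//; last 4 first.
  - by apply: bddM => //; exact: bdd_cst.
  - by apply: bddM => //; exact: bdd_cst.
  - exact: bdd_cst.
  - by apply: bddD; apply: bddM => //; exact: bdd_cst.
  have h5 : \int[P]_w \1_A w <= e'.
    rewrite Rintegral_indic//.
    by rewrite -lee_fin fineK ?fin_num_measure.
  have M20 : 0 <= 2 * M by lra.
  have h6 := ler_wpM2l M20 h5; have h7 := ler_wpM2l M20 h2.
  have e'E : e' * (1 + 4 * M) = e / 2 by rewrite divfK// gt_eqF.
  have h8 := lerD h6 h7.
  apply: (@le_trans _ _ (e' + (2 * M * e' + 2 * M * e'))); first by rewrite lerD2l addrC.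
  by rewrite -e'E; lra.
have := ler_distD (\int[P]_w f (X n w)) (\int[F]_x f x) (\int[P]_w f (Y n w)).
lra.
Unshelve. all: by end_near. Qed.

(** A nonpositive mean makes the integral of [clip1 1] vanish, so [sqchf] is [1] on [[0, 1]] by
    [sqchf_dist], and [trunc_sqr] at [1] would be [0]. *)
Lemma mean_gt0 d (T : measurableType d) (R : realType) (P : probability T R)
    (W : T -> R) : P.-integrable setT (EFin \o W) -> (forall w, 0 <= W w) ->
  0 < trunc_sqr P W 1 -> 0 < \int[P]_w W w.
Proof.
move=> iW W0 S0.
have mW : measurable_fun setT W by apply/measurable_EFinP; exact: measurable_int iW.
rewrite ltNge; apply/negP => I0.
have cI : \int[P]_w clip1 1 (W w) <= 0.
  apply: le_trans I0; apply: le_Rintegral => //.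
    by apply: bdd_integrable; exact: bdd_clip1.
  by move=> w _; rewrite /clip1 mul1r ger0_norm// ge_min lexx orbT.
suff : trunc_sqr P W 1 <= trunc_cst R * 0 by rewrite mulr0 leNgt S0.
apply: trunc_sqr_le => // s /andP[s0 s1].
have s01 : `|s - 0| <= 1 by rewrite subr0 ger0_norm.
have := sqchf_dist P mW ler01 s01; rewrite sqchf0// mulr1 => /ler_normlP[+ _].
by lra.
Qed.

Lemma integral_id d (T : measurableType d) (R : realType) (P : probability T R)
    (X Y : {RV P >-> R}) (f : R -> R) : identically_distributed X Y ->
  measurable_fun setT f -> (forall x, 0 <= f x) ->
  (\int[P]_w (f (X w))%:E = \int[P]_w (f (Y w))%:E)%E.
Proof.
move=> XY mf f0.
have mf' : measurable_fun setT (fun x => (f x)%:E) by exact/measurable_EFinP.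
have f0' x : (0 <= (f x)%:E)%E by rewrite lee_fin.
rewrite -(ge0_integral_distribution X mf' f0') -(ge0_integral_distribution Y mf' f0').
by apply: eq_measure_integral => A mA _; exact: XY.
Qed.

Lemma le_powRN (R : realType) (u v r : R) : 0 < u -> u <= v -> 0 <= r ->
  v `^ (- r) <= u `^ (- r).
Proof.
move=> u0 uv r0; have v0 := lt_le_trans u0 uv.
rewrite !powRN lef_pV2 ?posrE ?powR_gt0//.
by apply: ge0_ler_powR => //; rewrite nnegrE ltW.
Qed.

(** * Expected size of the error terms *)

Section expected_errors.
Context d (T : measurableType d) (R : realType) (P : probability T R).
Context (Ws : nat -> {RV P >-> R}) (indep : mutually_independent Ws).
Context (Ws0 : forall i w, 0 <= Ws i w).

Lemma measurable_powR_mul n (g : R) (i : 'I_n) :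
  measurable_fun setT (fun w => \sum_(j < n | j != i) (Ws i w `^ g * Ws j w `^ g)).
Proof.
rewrite (_ : (fun w => _) =
  (fun w => \sum_(j < n) (if j != i then Ws i w `^ g * Ws j w `^ g else 0))).
  apply: measurable_sum => j; case: (j != i) => //.
  by apply: measurable_funM; exact: (measurableT_comp (measurable_powR g)).
by apply/funext => w; rewrite big_mkcond.
Qed.

(** Independence factors the product for [j != i] only; on the diagonal it would produce a moment of
    order [2 g], which need not be finite. This is why the diagonal is kept apart in
    [grg_deficit]. *)
Lemma integral_sum_powR (n : nat) (g m : R) (c1 c2 : R) : 0 <= c1 -> 0 <= c2 ->
  (forall i, (\int[P]_w (Ws i w `^ g)%:E = m%:E)%E) ->
  (\int[P]_w (c1 * (\sum_(i < n) Ws i w `^ g) +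
    c2 * (\sum_(i < n) \sum_(j < n | j != i) (Ws i w `^ g * Ws j w `^ g)))%:E <=
  (c1 * (n%:R * m) + c2 * (n%:R ^+ 2 * m ^+ 2))%:E)%E.
Proof.
move=> c10 c20 Hm.
have mp i : measurable_fun setT (fun w => Ws i w `^ g).
  exact: (measurableT_comp (measurable_powR g)).
have m0 : 0 <= m.
  rewrite -lee_fin -(Hm 0%N); apply: integral_ge0 => w _.
  by rewrite lee_fin powR_ge0.
have p0 i w : 0 <= Ws i w `^ g by exact: powR_ge0.
have m1 : measurable_fun setT (fun w => \sum_(i < n) Ws i w `^ g).
  by apply: measurable_sum => i.
have m2' (i : 'I_n) := measurable_powR_mul g i.
have m2 : measurable_fun setT (fun w => \sum_(i < n) \sum_(j < n | j != i) (Ws i w `^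
    g * Ws j w `^ g)).
  by apply: measurable_sum => i.
have s1 w : 0 <= \sum_(i < n) Ws i w `^ g by exact: sumr_ge0.
have s2' w (i : 'I_n) : 0 <= \sum_(j < n | j != i) (Ws i w `^ g * Ws j w `^ g).
  by apply: sumr_ge0 => j _; exact: mulr_ge0.
have s2 w : 0 <= \sum_(i < n) \sum_(j < n | j != i) (Ws i w `^ g * Ws j w `^ g).
  by apply: sumr_ge0 => i _; exact: s2'.
have I1 : (\int[P]_w (\sum_(i < n) Ws i w `^ g)%:E = (n%:R * m)%:E)%E.
  under eq_integral do rewrite -sumEFin.
  rewrite ge0_integral_sum//; last 2 first.
  - by move=> i; exact/measurable_EFinP.
  - by move=> i w _; rewrite lee_fin.
  under eq_bigr do rewrite Hm.
  by rewrite sumEFin sumr_const card_ord mulr_natl.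
have I2' (i : 'I_n) : (\int[P]_w (\sum_(j < n | j != i) (Ws i w `^ g * Ws j w `^ g))%:E <=
    (n%:R * m ^+ 2)%:E)%E.
  under eq_integral do rewrite -sumEFin -big_filter.
  rewrite ge0_integral_sum//; last 2 first.
  - by move=> j; apply/measurable_EFinP; exact: measurable_funM.
  - by move=> j w _; rewrite lee_fin mulr_ge0.
  rewrite big_filter.
  apply: (@le_trans _ _ (\sum_(j < n | j != i) (m ^+ 2)%:E)%E).
    apply: lee_sum => j ji.
    rewrite (@ge0_integral_independent2 _ _ _ P (Ws i) (Ws j) (@powR R ^~ g) (@powR R
        ^~ g))//.
    - by rewrite !Hm -EFinM.
    - by apply: independent2_pair => //; rewrite eq_sym.
    - by move=> x; exact: powR_ge0.
    - by move=> x; exact: powR_ge0.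
  rewrite sumEFin lee_fin sumr_const -[(m ^+ 2) *+ _]mulr_natl ler_wpM2r ?sqr_ge0// ler_nat.
  by rewrite -[leqRHS]card_ord max_card.
have I2 : (\int[P]_w (\sum_(i < n) \sum_(j < n | j != i) (Ws i w `^ g * Ws j w `^ g))%:E <=
    (n%:R ^+ 2 * m ^+ 2)%:E)%E.
  under eq_integral do rewrite -sumEFin.
  rewrite ge0_integral_sum//; last 2 first.
  - by move=> i; exact/measurable_EFinP.
  - by move=> i w _; rewrite lee_fin.
  apply: (@le_trans _ _ (\sum_(i < n) (n%:R * m ^+ 2)%:E)%E); first exact: lee_sum.
  by rewrite sumEFin sumr_const card_ord lee_fin -[(n%:R * m ^+ 2) *+ n]mulr_natl mulrA.
under eq_integral do rewrite EFinD !EFinM.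
rewrite ge0_integralD//; last 4 first.
- by move=> w _; rewrite -EFinM lee_fin mulr_ge0.
- by apply: emeasurable_funM => //; exact/measurable_EFinP.
- by move=> w _; rewrite -EFinM lee_fin mulr_ge0.
- by apply: emeasurable_funM => //; exact/measurable_EFinP.
rewrite !ge0_integralZl//;
  try first [exact/measurable_EFinP|by move=> w _; rewrite lee_fin].
by rewrite I1 EFinD leeD// EFinM lee_wpmul2l ?lee_fin.
Qed.

Lemma edges_second_moment_le (n : nat) (G : T -> rel 'I_n) (mu : R) :
  generalized_random_graph (fun i : 'I_n => Ws i) G ->
  (forall i, (\int[P]_w (Ws i w)%:E = mu%:E)%E) ->
  \int[P]_w (\sum_(e : 'I_n * 'I_n | (e.1 < e.2)%N)
    (edge R G e w - edge_prob (fun i : 'I_n => Ws i) e w)) ^+ 2 <= n%:R * mu.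
Proof.
move=> HG Hmu; pose W := fun i : 'I_n => Ws i.
have W0 (i : 'I_n) w : 0 <= W i w by exact: Ws0.
apply: le_trans (edges_second_moment W0 HG) _.
have bp (e : 'I_n * 'I_n) : (e.1 < e.2)%N -> bdd_measurable (edge_prob W e).
  by move=> e12; exact: (bdd_edge_prob W0 HG).
rewrite -bdd_Rintegral_sum// -lee_fin /Rintegral fineK; last first.
  by apply: integrable_fin_num => //; apply: bdd_integrable; exact: bdd_sum.
have mS : measurable_fun setT (fun w => \sum_(i < n) Ws i w) by exact:
    measurable_partial_sum.
apply: (@le_trans _ _ (\int[P]_w (\sum_(i < n) Ws i w)%:E)%E).
  apply: ge0_le_integral => //.
  - move=> w _; rewrite lee_fin; apply: sumr_ge0 => e _.
    by have /andP[] := edge_prob_itv W0 e w.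
  - by apply/measurable_EFinP; have [] := @bdd_sum _ T R _ (index_enum _) _ _ bp.
  - exact/measurable_EFinP.
  move=> w _; rewrite lee_fin.
  have L0 : 0 <= \sum_(i < n) Ws i w by apply: sumr_ge0.
  (* A zero total falls outside [grg_deficit]; there every edge probability is [0] by convention. *)
  have [L00|Ln0] := eqVneq (\sum_(i < n) Ws i w) 0.
    rewrite L00 big1// => e _; rewrite /edge_prob /grg_prob.
    by rewrite -[X in if X == _ then _ else _]/(\sum_(k < n) Ws k w) L00 eqxx.
  have Lgt : 0 < \sum_(k < n) W k w by rewrite lt0r Ln0.
  (* The nonnegativity half of [grg_deficit] gives twice the sum of the probabilities at most the
     total weight; [1] is one admissible exponent. *)
  have g12 : 1 <= (1 : R) <= 2 by rewrite lexx ler1n.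
  have := @grg_deficit R n (fun i => W i w) 1 (fun i => W0 i w) Lgt g12.
  have p0 : 0 <= \sum_(e : 'I_n * 'I_n | (e.1 < e.2)%N) edge_prob W e w.
    by apply: sumr_ge0 => e _; have /andP[] := edge_prob_itv W0 e w.
  by move=> /andP[+ _]; rewrite /edge_prob in p0 *; lra.
under eq_integral do rewrite -sumEFin.
rewrite ge0_integral_sum//; last 2 first.
- by move=> i; exact/measurable_EFinP.
- by move=> i w _; rewrite lee_fin.
under eq_bigr do rewrite Hmu.
by rewrite sumEFin sumr_const card_ord -[mu *+ n]mulr_natl.
Qed.

End expected_errors.

Section edges_weights.
Context d (T : measurableType d) (R : realType) (P : probability T R).
Context (Ws : nat -> {RV P >-> R}) (indep : mutually_independent Ws).
Context (Ws0 : forall i w, 0 <= Ws i w).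

Lemma measurable_num_edges n (G : T -> rel 'I_n) :
  generalized_random_graph (fun i : 'I_n => Ws i) G ->
  measurable_fun setT (fun w => (num_edges (G w))%:R : R).
Proof.
move=> HG.
rewrite (_ : (fun w => _) = (fun w => \sum_(e : 'I_n * 'I_n | (e.1 < e.2)%N) edge R G e w)).
  have be (e : 'I_n * 'I_n) : (e.1 < e.2)%N -> bdd_measurable (edge R G e).
    by move=> _; exact: (bdd_edge HG).
  by have [] := @bdd_sum _ T R _ (index_enum _) _ _ be.
by apply/funext => w; rewrite num_edgesE.
Qed.

(** Off [B1] the total weight exceeds half its mean [L], so its random nonpositive powers in
    [grg_deficit] are bounded by those of the constant [L] before expectations are taken. Of the
    tolerance [dl * a], one half goes to twice the edge deviation ([B2]) and one half to the deficit
    ([B3]). *)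
Lemma edges_weights_dist n (G : T -> rel 'I_n) (a mu dl g m : R) :
  generalized_random_graph (fun i : 'I_n => Ws i) G ->
  (forall i, (\int[P]_w (Ws i w)%:E = mu%:E)%E) ->
  (forall i, (\int[P]_w (Ws i w `^ g)%:E = m%:E)%E) ->
  (0 < n)%N -> 0 < a -> 0 < mu -> 0 < dl -> 1 <= g <= 2 ->
  let X w := (\sum_(i < n) Ws i w - n%:R * mu) / a in
  let Y w := (2 * (num_edges (G w))%:R - n%:R * mu) / a in
  let L := n%:R * mu / 2 in
  is_true (P [set w | (dl < `|X w - Y w|)%R] <=
    P [set w | (L / a <= `|X w|)%R] +
    ((((dl * a / 4) ^+ 2)^-1 * (n%:R * mu))%:E +
     ((dl * a / 2)^-1 * (L `^ (1 - g) * (n%:R * m) + L `^ (- g) * (n%:R ^+ 2 * m ^+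
         2)))%:E))%E.
Proof.
move=> HG Hmu Hm n0 a0 mu0 dl0 g12 X Y L.
have n0' : 0 < n%:R :> R by rewrite ltr0n.
have L0 : 0 < L by rewrite divr_gt0// mulr_gt0.
pose W := fun i : 'I_n => Ws i.
have W0 (i : 'I_n) w : 0 <= W i w by exact: Ws0.
pose N w : R := (num_edges (G w))%:R.
pose M w := \sum_(e : 'I_n * 'I_n | (e.1 < e.2)%N) (edge R G e w - edge_prob W e w).
pose Z w := L `^ (1 - g) * (\sum_(i < n) Ws i w `^ g) +
  L `^ (- g) * (\sum_(i < n) \sum_(j < n | j != i) (Ws i w `^ g * Ws j w `^ g)).
have bM : bdd_measurable M.
  apply: bdd_sum => e e12; apply: bddB; first exact: (bdd_edge HG).
  exact: (bdd_edge_prob W0 HG).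
have mM2 : measurable_fun setT (fun w => M w ^+ 2) by apply: measurable_funX; case: bM.
have mp i : measurable_fun setT (fun w => Ws i w `^ g).
  exact: (measurableT_comp (measurable_powR g)).
have mZ : measurable_fun setT Z.
  apply: measurable_funD; apply: measurable_funM => //; first by apply: measurable_sum => i.
  by apply: measurable_sum => i; exact: measurable_powR_mul.
have Z0 w : 0 <= Z w.
  by rewrite addr_ge0// mulr_ge0 ?powR_ge0// sumr_ge0// => i _;
      rewrite ?powR_ge0// sumr_ge0// => j _; rewrite mulr_ge0 ?powR_ge0.
have mX : measurable_fun setT X.
  apply: measurable_funM => //; apply: measurable_funB => //; exact: measurable_partial_sum.
have mY : measurable_fun setT Y.
  apply: measurable_funM => //; apply: measurable_funB => //; apply: measurable_funM => //.
  exact: measurable_num_edges.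
pose B1 := [set w | L / a <= `|X w|].
pose B2 := [set w | (dl * a / 4) ^+ 2 <= M w ^+ 2].
pose B3 := [set w | dl * a / 2 <= Z w].
have mB1 : measurable B1 by apply: measurable_set_ge; exact: measurableT_comp.
have mB2 : measurable B2 by exact: measurable_set_ge.
have mB3 : measurable B3 by exact: measurable_set_ge.
have mB23 : measurable (B2 `|` B3) by exact: measurableU.
have mB : measurable (B1 `|` (B2 `|` B3)) by exact: measurableU.
have mA : measurable [set w | dl < `|X w - Y w|].
  by apply: measurable_set_gt; apply: measurableT_comp => //; exact: measurable_funB.
have da0 : 0 < dl * a by rewrite mulr_gt0.
have incl : [set w | dl < `|X w - Y w|] `<=` B1 `|` (B2 `|` B3).
  move=> w /= XY; apply: contrapT => /not_orP[nB1 /not_orP[nB2 nB3]].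
  have {}nB1 : `|X w| < L / a by rewrite ltNge; apply/negP.
  have {}nB2 : M w ^+ 2 < (dl * a / 4) ^+ 2 by rewrite ltNge; apply/negP.
  have {}nB3 : Z w < dl * a / 2 by rewrite ltNge; apply/negP.
  have Ma : `|M w| < dl * a / 4.
    rewrite ltNge; apply/negP => h; move: nB2; rewrite ltNge => /negP; apply.
    by rewrite -[leRHS]real_normK ?num_real// lerXn2r ?nnegrE// divr_ge0 ?(ltW da0).
  have SL : L < \sum_(i < n) Ws i w.
    move: nB1; rewrite /X normrM normfV (gtr0_norm a0) ltr_pM2r ?invr_gt0//.
    by move=> /ltr_normlP[]; rewrite /L; lra.
  have S0 : 0 < \sum_(k < n) W k w by exact: lt_trans SL.
  have /andP[D1 D2] := @grg_deficit R n (fun i => W i w) g (fun i => W0 i w) S0 g12.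
  have D3 : \sum_(i < n) Ws i w - 2 * \sum_(e : 'I_n * 'I_n | (e.1 < e.2)%N)
      edge_prob W e w <= Z w.
    apply: (le_trans D2); have /andP[g1 g2] := g12.
    apply: lerD; apply: ler_wpM2r.
    - by apply: sumr_ge0 => i _; exact: powR_ge0.
    - by rewrite -(opprB g); apply: le_powRN => //; [exact: ltW|lra].
    - by apply: sumr_ge0 => i _; apply: sumr_ge0 => j _; rewrite mulr_ge0 ?powR_ge0.
    - by apply: le_powRN => //; [exact: ltW|lra].
  have ME : M w = N w - \sum_(e : 'I_n * 'I_n | (e.1 < e.2)%N) edge_prob W e w.
    by rewrite /M sumrB /N num_edgesE.
  move: XY; rewrite /X /Y -mulrBl normrM normfV (gtr0_norm a0) ltr_pdivlMr//.
  rewrite ltNge => /negP; apply; rewrite -/(N w).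
  move/ltr_normlP: Ma => [M1 M2]; rewrite /edge_prob in D3 ME.
  by rewrite ler_norml; apply/andP; split; lra.
apply: (@le_trans _ _ (P (B1 `|` (B2 `|` B3)))).
  by apply: le_measure => //; exact: mem_set.
apply: (le_trans (measureU2 _ mB1 mB23)); apply: leeD => //.
apply: (le_trans (measureU2 _ mB2 mB3)); apply: leeD.
  have c0 : 0 < (dl * a / 4) ^+ 2 by rewrite exprn_gt0// divr_gt0.
  apply: le_trans (markov_ge0 P mM2 (fun w => sqr_ge0 _) c0) _.
  rewrite EFinM; apply: lee_wpmul2l; first by rewrite lee_fin invr_ge0 ltW.
  have := edges_second_moment_le Ws0 HG Hmu.
  rewrite -lee_fin /Rintegral fineK//.
  apply: integrable_fin_num => //; apply: bdd_integrable.
  by rewrite (_ : (fun w => _) = (fun w => M w * M w))//; exact: bddM.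
have c0 : 0 < dl * a / 2 by rewrite divr_gt0.
apply: le_trans (markov_ge0 P mZ Z0 c0) _.
rewrite EFinM; apply: lee_wpmul2l; first by rewrite lee_fin invr_ge0 ltW.
exact: (integral_sum_powR indep n (powR_ge0 _ _) (powR_ge0 _ _) Hm).
Qed.

End edges_weights.

(* [(2 - alpha) * alpha = 1 - (alpha - 1) ^ 2 < 1] leaves room for [eps]. *)
Lemma exponent_gap (R : realFieldType) (alpha : R) : 1 < alpha -> alpha < 2 ->
  exists g b b' : R, [/\ 1 <= g <= 2, 0 < g < b, 1 < b & b < alpha] /\
    [/\ alpha < b', (2 - g) * b' < 1 & 2^-1 * b' < 1].
Proof.
(* Both [(alpha - 1) ^+ 2] and [2 - alpha] are at most [1], so [eps] is at most an eighth of each: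
   the first controls [(2 - g) * b' < 1], the second [b' < 2]. *)
move=> al1 al2; pose eps := (alpha - 1) ^+ 2 * (2 - alpha) / 8.
have eps0 : 0 < eps by rewrite divr_gt0// mulr_gt0 ?exprn_gt0 ?subr_gt0.
have epsE : eps * 8 = (alpha - 1) ^+ 2 * (2 - alpha) by rewrite divfK.
have eps1 : 8 * eps <= (alpha - 1) ^+ 2.
  rewrite mulrC epsE ler_piMr ?sqr_ge0//; lra.
have a11 : (alpha - 1) ^+ 2 <= alpha - 1 by rewrite expr2 ler_piMl//; lra.
have eps2 : 8 * eps <= 2 - alpha by rewrite mulrC epsE ler_piMl//; lra.
exists (alpha - 2 * eps), (alpha - eps), (alpha + eps).
split; split; try (apply/andP; split); try lra.
have -> : (2 - (alpha - 2 * eps)) * (alpha + eps) =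
    1 - (alpha - 1) ^+ 2 + eps * (2 + alpha) + 2 * (eps * eps) by ring.
have : eps * (2 + alpha) <= eps * 4 by rewrite ler_wpM2l//; lra.
have : eps * eps <= eps * 1 by rewrite ler_wpM2l//; lra.
lra.
Qed.

Theorem theorem2 (R : realType) (d : measure_display) (T : measurableType d)
    (P : probability T R)
    (W : {RV P >-> R}) (Ws : nat -> {RV P >-> R})
    (a : nat -> R) (alpha : R) (F : probability R R)
    (G : forall n : nat, T -> rel 'I_n) :
  mutually_independent Ws ->
  (forall i, identically_distributed (Ws i) W) ->
  (forall w, 0 <= W w) ->
  (forall i w, 0 <= Ws i w) ->
  ('E_P[W] < +oo)%E ->
  (forall n, (0 < n)%N -> 0 < a n) ->
  1 < alpha < 2 ->
  stable_law alpha F ->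
  cvg_in_distribution P
    (fun n w => (\sum_(i < n) Ws i w - n%:R * fine 'E_P[W]) / a n) F ->
  (forall n, (0 < n)%N ->
     generalized_random_graph (fun i : 'I_n => Ws i) (G n)) ->
  cvg_in_distribution P
    (fun n w => (2 * (num_edges (G n w))%:R - n%:R * fine 'E_P[W]) / a n) F.
Proof.
move=> indep WW W0 Ws0 EW a0 /andP[al1 al2] stF XF HG.
set mu := fine 'E_P[W] in XF *.
set X := (fun n w => _) in XF; set Y := (fun n w => _).
have al0 : 0 < alpha by exact: lt_trans al1.
have mW : measurable_fun setT W by [].
have iW : P.-integrable setT (EFin \o W).
  apply/integrableP; split; first exact/measurable_EFinP.
  rewrite unlock in EW; apply: le_lt_trans EW.
  by rewrite le_eqVlt; apply/orP; left; apply/eqP/eq_integral => w _; rewrite /= ger0_norm.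
have muE : (\int[P]_w (W w)%:E = mu%:E)%E.
  by rewrite /mu unlock fineK//; exact: integrable_fin_num.
have Hmu i : (\int[P]_w (Ws i w)%:E = mu%:E)%E.
  rewrite -muE; transitivity (\int[P]_w (`|Ws i w|)%:E)%E.
    by apply: eq_integral => w _; rewrite ger0_norm.
  rewrite (integral_id (f := fun x : R => `|x|) (WW i))//.
  by apply: eq_integral => w _; rewrite ger0_norm.
have mX n : measurable_fun setT (X n).
  apply: measurable_funM => //; apply: measurable_funB => //; exact: measurable_partial_sum.
have mY n : measurable_fun setT (Y n).
  apply: measurable_funM => //; apply: measurable_funB => //; apply: measurable_funM => //.
  (* The graph hypothesis starts at [n = 1]; for [n = 0] there is no edge to count. *)
  have [->|n0] := posnP n; last exact: measurable_num_edges (HG n n0).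
  rewrite (_ : (fun w => _) = (fun=> 0)); first exact: measurable_cst.
  by apply/funext => w; rewrite /num_edges big_ord0.
have XE n t : (0 < n)%N -> sqchf P (X n) t = sqchf P W (t / a n) ^+ n.
  move=> n0; rewrite -(sqchf_partial_sum indep n (t / a n) WW).
  rewrite -(sqchf_affine _ _ (- (n%:R * mu / a n)) t (measurable_partial_sum Ws n)).
  rewrite /sqchf; congr (_ ^+ 2 + _ ^+ 2); apply: eq_Rintegral => w _;
    by rewrite /X mulrBl [X in X - _]mulrC.
have [t0 [c1 [c2 [t00 c10 c20 Hb]]]] := trunc_sqr_bounds mW mX al0 stF XF a0 XE.
have le_S (u v : R) : 0 < u -> u <= v -> trunc_sqr P W u <= trunc_sqr P W v.
  exact: le_trunc_sqr.
have S_sqr (l u : R) : 0 < l <= 1 -> 0 < u -> l ^+ 2 * trunc_sqr P W u <=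
    trunc_sqr P W (l * u).
  exact: trunc_sqr_scale.
have mu0 : 0 < mu.
  have := mean_gt0 iW W0 (Psi_gt0 t00 c10 a0 le_S S_sqr Hb ltr01).
  by rewrite /Rintegral muE.
have [g [b [b' [[g12 gb b1 bal] [b'al pb1 pb2]]]]] := exponent_gap al1 al2.
have b'0 : 0 < b' by exact: lt_trans b'al.
have bal' : 0 < b < alpha by rewrite bal andbT (lt_trans _ b1).
have [K K0 HK] := Psi_le_powR al0 t00 c10 c20 a0 le_S S_sqr Hb bal'.
have mom := moment_lty W0 (ltW K0) gb HK.
pose m := fine (\int[P]_w (W w `^ g)%:E)%E.
have mE : (\int[P]_w (W w `^ g)%:E = m%:E)%E.
  rewrite /m fineK// ge0_fin_numE//; apply: integral_ge0 => w _.
  by rewrite lee_fin powR_ge0.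
have Hm i : (\int[P]_w (Ws i w `^ g)%:E = m%:E)%E.
  rewrite -mE (integral_id (f := @powR R ^~ g) (WW i))//.
  by move=> x; exact: powR_ge0.
have m0 : 0 <= m.
  rewrite -lee_fin -mE; apply: integral_ge0 => w _.
  by rewrite lee_fin powR_ge0.
have [Ka Ka0 Hle] := norming_le al0 t00 c10 c20 a0 le_S S_sqr Hb bal'.
have [ka ka0 Hge] := norming_ge al0 t00 c10 c20 a0 le_S S_sqr Hb b'al.
apply: (slutsky mX mY XF) => dl e dl0 e0.
have e30 : 0 < e / 3 by rewrite divr_gt0.
have [d1 d10 Hd1] := clip1_tight XF e30.
(* The expected deficit is at most [n ^ (2 - g) * (C3 - 1)]; the added [1] makes [C3] positive, so
   that it can be divided by. *)
pose C3 := (mu / 2) `^ (1 - g) * m + (mu / 2) `^ (- g) * m ^+ 2 + 1.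
have C30 : 0 < C3.
  by rewrite ltr_wpDl// addr_ge0// mulr_ge0 ?powR_ge0 ?sqr_ge0.
(* Once [n] exceeds this multiple of [a n], the first event forces [d1 * |X n| >= 1], that is
   [clip1 d1 (X n) = 1], and tightness bounds its probability. *)
have mud0 : 0 < 2 / (mu * d1) by rewrite divr_gt0// mulr_gt0.
(* The minimum with [1] gives [eta2 ^+ 2 <= eta2], needed after squaring the bound on [n ^ (1 / 2)];
   [48] is [3 * 16], from [e / 3] and the square of [dl * a n / 4]. *)
pose eta2 := Num.min 1 (e * dl ^+ 2 / (48 * mu)).
have eta20 : 0 < eta2.
  by rewrite lt_min ltr01 divr_gt0 ?mulr_gt0 ?exprn_gt0.
have eta30 : 0 < e * dl / (6 * C3) by rewrite divr_gt0 ?mulr_gt0.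
near=> n.
have n0 : (0 < n)%N by near: n; exact: nbhs_infty_gt.
have n0' : 0 < n%:R :> R by rewrite ltr0n.
have an0 := a0 n n0.
have h1 : 2 / (mu * d1) * a n <= n%:R.
  by near: n; exact: (near_norming_le a0 b1 Ka0 mud0 Hle).
have h2 : n%:R `^ 2^-1 <= eta2 * a n.
  by near: n; exact: (near_powR_le_norming a0 b'0 ka0 pb2 eta20 Hge).
have h3 : n%:R `^ (2 - g) <= e * dl / (6 * C3) * a n.
  by near: n; exact: (near_powR_le_norming a0 b'0 ka0 pb1 eta30 Hge).
have h4 : \int[P]_w clip1 d1 (X n w) <= e / 3 by near: n; exact: Hd1.
apply: le_trans (edges_weights_dist indep Ws0 (HG n n0) Hmu Hm n0 an0 mu0 dl0 g12) _.
have -> : e%:E = ((e / 3)%:E + ((e / 3)%:E + (e / 3)%:E))%E.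
  by rewrite -!EFinD; congr EFin; field.
apply: leeD; last apply: leeD.
- rewrite -/(X n); set B := [set w | _].
  have mB : measurable B.
    apply: measurable_set_ge; exact: (measurableT_comp (@normr_measurable R setT) (mX n)).
  rewrite -[P B]fineK ?fin_num_measure// lee_fin; apply: le_trans h4.
  rewrite -Rintegral_indic//; apply: le_bdd_Rintegral; first exact: bdd_indic.
    exact: (bdd_clip1 (ltW d10) (mX n)).
  move=> w; rewrite indicE; case: (boolP (w \in B)) => [/set_mem wB|_]; last first.
    by rewrite clip1_ge0// ltW.
  rewrite /clip1 le_min lexx/=; apply: le_trans (ler_wpM2l (ltW d10) wB).
  have : 2 / (mu * d1) * a n * (d1 * mu / 2 / a n) <= n%:R * (d1 * mu / 2 / a n).
    rewrite ler_wpM2r// !mulr_ge0 ?invr_ge0// ltW//.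
  rewrite [leLHS](_ : _ = 1); last by field; rewrite !gt_eqF.
  by move=> h; apply: (le_trans h); rewrite le_eqVlt; apply/orP; left; apply/eqP;
      field; rewrite gt_eqF.
- rewrite lee_fin.
  have hs : n%:R <= (e * dl ^+ 2 / (48 * mu)) * a n ^+ 2.
    have sq : n%:R = (n%:R `^ 2^-1) ^+ 2 :> R.
      by rewrite -powR_mulrn ?powR_ge0// -powRrM mulVf// powRr1.
    rewrite sq.
    apply: (@le_trans _ _ ((eta2 * a n) ^+ 2)).
      by rewrite lerXn2r ?nnegrE ?powR_ge0// mulr_ge0 ?(ltW eta20) ?(ltW an0).
    rewrite exprMn ler_wpM2r ?sqr_ge0//.
    apply: (@le_trans _ _ eta2); last by rewrite ge_min lexx orbT.
    by rewrite expr2 ler_piMl ?(ltW eta20)// ge_min lexx.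
  have da : 0 < (dl * a n / 4) ^+ 2 by rewrite exprn_gt0// divr_gt0// mulr_gt0.
  rewrite mulrC ler_pdivrMr//.
  have := ler_wpM2r (ltW mu0) hs.
  rewrite [leRHS](_ : _ = e / 3 * (dl * a n / 4) ^+ 2)//.
  by field; rewrite gt_eqF.
- rewrite lee_fin.
  have dla : 0 < dl * a n / 2 by rewrite divr_gt0// mulr_gt0.
  rewrite mulrC ler_pdivrMr//.
  have p1 : (n%:R * mu / 2) `^ (1 - g) = n%:R `^ (1 - g) * (mu / 2) `^ (1 - g).
    by rewrite -mulrA powRM// divr_ge0// ltW.
  have p2 : (n%:R * mu / 2) `^ (- g) = n%:R `^ (- g) * (mu / 2) `^ (- g).
    by rewrite -mulrA powRM// divr_ge0// ltW.
  have p3 : n%:R `^ (1 - g) * n%:R = n%:R `^ (2 - g).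
    rewrite -[X in _ * X](powRr1 (ltW n0')) -powRD; last by rewrite (gt_eqF n0') implybT.
    by congr powR; ring.
  have p4 : n%:R `^ (- g) * n%:R ^+ 2 = n%:R `^ (2 - g).
    rewrite -powR_mulrn// -powRD; last by rewrite (gt_eqF n0') implybT.
    by congr powR; ring.
  have -> : (n%:R * mu / 2) `^ (1 - g) * (n%:R * m) + (n%:R * mu / 2) `^ (- g) *
      (n%:R ^+ 2 * m ^+ 2) =
      n%:R `^ (2 - g) * (C3 - 1).
    by rewrite p1 p2 /C3 addrK mulrDr -{1}p3 -p4; ring.
  apply: (@le_trans _ _ (n%:R `^ (2 - g) * C3)).
    by rewrite ler_wpM2l ?powR_ge0// gerBl.
  apply: (le_trans (ler_wpM2r (ltW C30) h3)).
  by rewrite le_eqVlt; apply/orP; left; apply/eqP; field; rewrite gt_eqF.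
Unshelve. all: by end_near. Qed.
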